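(* Let $K$ be a number field and $\Omega$ its set of places. Let $S\subset\mathbb{P}^3$ be a smooth cubic surface over $K$ with $S(\mathbb{A}_K)\neq\emptyset$. Let $\Sigma$ be a subset of $\Omega$ and let $\mathbb{A}_K^\Sigma$ denote the adeles of $K$ with the $\Sigma$ components removed. Suppose that the image of $S(K)$ in $S(\mathbb{A}_K^\Sigma)$ is dense. Let $\Delta$ be a finite subset of $\Omega \backslash \Sigma$. Then the diagonal map \[ H^0_S(K) \rightarrow \prod_{\upsilon \in \Delta} H^0_S(K_\upsilon) \] is surjective.
   Context: $\mathbb{A}_K$ denotes the adeles of $K$ and $K_\upsilon$ the completion of $K$ at $\upsilon$. The diagonal map is the one induced by the inclusions $S(K)\subseteq S(K_\upsilon)$. The group $H_S(L)$, for a field $L$ over which the smooth cubic surface $S\subset\mathbb{P}^3$ is defined: An $L$-line is a line $\ell \subset \mathbb{P}^3$ defined over $L$. If $\ell \not\subset S$ is an $L$-line, then $\ell\cdot S = P+Q+R$ denotes the intersection of $\ell$ with $S$ counted with multiplicity. Let $G_S(L)=\bigoplus_{P\in S(L)}\mathbb{Z}\cdot P$ be the free abelian group on $S(L)$. Let $G'_S(L)$ be the subgroup generated by all sums $P+Q+R$ with $P,Q,R\in S(L)$ (not necessarily distinct) such that (i) there is an $L$-line $\ell$ not contained in $S$ with $\ell\cdot S=P+Q+R$, or (ii) there is an $L$-line $\ell$ contained in $S$ with $P,Q,R\in\ell$. Let $\deg:G_S(L)\to\mathbb{Z}$, $\deg(\sum a_iP_i)=\sum a_i$, let $G''_S(L)=\{D\in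 G'_S(L):\deg(D)=0\}$, and $H_S(L)=G_S(L)/G''_S(L)$. The degree map descends to $\deg:H_S(L)\to\mathbb{Z}$, and $H^0_S(L)=\{D\in H_S(L):\deg(D)=0\}$. *)

(* Defs.v *)
From HB Require Import structures.
From mathcomp Require Import all_boot all_order all_algebra all_field.
From mathcomp Require Import generic_quotient ring_quotient.
From mathcomp Require Import boolp classical_sets functions cardinality.
From mathcomp Require Import reals exp topology.
From mathcomp Require Import freeg mpoly.

Set Implicit Arguments.
Unset Strict Implicit.
Unset Printing Implicit Defensive.

Import Order.TTheory GRing.Theory Num.Theory.
Local Open Scope classical_set_scope.
Local Open Scope quotient_scope.
Local Open Scope ring_scope.

Section Surface.
Context (L : fieldType).

(* Points and L-lines of P^3 are the 1- and 2-dimensional subspaces of L^4. *)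
Definition proj_point := {P : {vspace 'rV[L]_4} | \dim P == 1}.
Definition proj_line := {l : {vspace 'rV[L]_4} | \dim l == 2}.

(* The zero form is allowed here; it is excluded by [smooth]. *)
Definition cubic_form := dhomog 4 L 3.

Definition on_surface (F : cubic_form) (P : proj_point) : bool :=
  (F : {mpoly L[4]}).@[vpick (val P) 0] == 0.

(* S(L) *)
Definition surface_point (F : cubic_form) := {P : proj_point | on_surface F P}.

Definition point_space (F : cubic_form) (P : surface_point F) :
  {vspace 'rV[L]_4} := val (val P).

(* The polynomial F(u + t w) in the variable t. *)
Definition along (F : cubic_form) (u w : 'rV[L]_4) : {poly L} :=
  mmap polyC (fun i => (u 0 i)%:P + w 0 i *: 'X) (F : {mpoly L[4]}).

(* Inclusion of schemes: F restricts to the zero form on l.  Over a finite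
   field this is stronger than asking that F vanish at the L-points of l. *)
Definition line_in_surface (F : cubic_form) (l : proj_line) : Prop :=
  forall u w, u \in val l -> w \in val l -> along F u w = 0.

(* For l not contained in S and X on l, the intersection multiplicity of l and
   S at X: the order of vanishing at t = 0 of F(u + t w), where u spans X and
   u, w span l. *)
Definition line_mult (F : cubic_form) (l : proj_line) (X : proj_point) : nat :=
  mup 0 (along F (vpick (val X)) (vpick (val l :\: val X)%VS)).

(* l . S = P + Q + R.  As l . S has degree 3, comparing multiplicities at the
   L-points of l is enough: no other point of l can then lie on S. *)
Definition line_cycle (F : cubic_form) (l : proj_line)
    (P Q R : surface_point F) : Prop :=
  [/\ (point_space P <= val l)%VS, (point_space Q <= val l)%VS,
      (point_space R <= val l)%VS
    & forall X : proj_point, (val X <= val l)%VS ->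
        line_mult F l X = ((X == val P) + (X == val Q) + (X == val R))%N].

Definition collinear_triple (F : cubic_form) (P Q R : surface_point F) : Prop :=
  exists l : proj_line,
    (~ line_in_surface F l /\ line_cycle l P Q R) \/
    [/\ line_in_surface F l, (point_space P <= val l)%VS,
        (point_space Q <= val l)%VS & (point_space R <= val l)%VS].

End Surface.

Section BaseChange.
Context (L M : fieldType) (f : {rmorphism L -> M}).

Fact map_cubic_subproof (F : cubic_form L) :
  map_mpoly f (F : {mpoly L[4]}) \is 3.-homog.
Proof.
apply/dhomogP => m; rewrite (perm_mem (msupp_map_mpoly _ (fmorph_inj f))).
exact/dhomogP/dhomog_is_dhomog.
Qed.

Definition map_cubic (F : cubic_form L) : cubic_form M :=
  DHomog (map_cubic_subproof F).

Lemma meval_dhomogZ (F : cubic_form L) c (x : 'rV[L]_4) :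
  (F : {mpoly L[4]}).@[(c *: x) 0] = c ^+ 3 * (F : {mpoly L[4]}).@[x 0].
Proof.
rewrite !mevalE mulr_sumr !big_seq; apply: eq_bigr => m mF.
rewrite (eq_bigr (fun i => c ^+ m i * x 0 i ^+ m i)); last first.
  by move=> i _; rewrite mxE exprMn.
rewrite big_split /= prodrXr mulrCA; congr (c ^+ _ * _).
have /dhomogP /(_ m mF) /= mdeg3 := dhomog_is_dhomog F.
by rewrite -mdegE mdeg3.
Qed.

Fact map_proj_point_subproof (P : proj_point L) :
  \dim <[map_mx f (vpick (val P))]> == 1.
Proof.
by rewrite dim_vline eqb1 map_mx_eq0 vpick0 -dimv_eq0 (eqP (valP P)).
Qed.

Definition map_proj_point (P : proj_point L) : proj_point M :=
  exist _ <[map_mx f (vpick (val P))]>%VS (map_proj_point_subproof P).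

End BaseChange.

Section SurfaceBaseChange.
Context (L M : fieldType) (f : {rmorphism L -> M}) (F : cubic_form L).

Fact map_point_subproof (P : surface_point F) :
  on_surface (map_cubic f F) (map_proj_point f (val P)).
Proof.
rewrite /on_surface /=; set y := map_mx f _.
have /vlineP [c ->] : vpick <[y]> \in <[y]>%VS := memv_pick _.
rewrite (meval_dhomogZ (map_cubic f F)); apply/eqP.
suff -> : (map_mpoly f (F : {mpoly L[4]})).@[y 0] = 0 by rewrite mulr0.
have /eqP F0 := valP P; rewrite -[RHS](rmorph0 f) -F0 !mevalE rmorph_sum /=.
rewrite (perm_big _ (msupp_map_mpoly _ (fmorph_inj f))) /=.
apply: eq_bigr => m _; rewrite mcoeff_map_mpoly rmorphM rmorph_prod /=.
by congr (_ * _); apply: eq_bigr => i _; rewrite rmorphXn mxE.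
Qed.

Definition map_point (P : surface_point F) : surface_point (map_cubic f F) :=
  exist _ (map_proj_point f (val P)) (map_point_subproof P).

End SurfaceBaseChange.

(* The Jacobian criterion: the closed subscheme F = dF/dx_0 = ... = dF/dx_3 = 0
   of P^3_L is empty, i.e. has no point over any extension of L. *)
Definition smooth (L : fieldType) (F : cubic_form L) : Prop :=
  forall (M : fieldType) (f : {rmorphism L -> M}) (x : 'rV[M]_4), x != 0 ->
    let FM : {mpoly M[4]} := map_cubic f F in
    ~ (FM.@[x 0] = 0 /\ forall i, (FM^`M(i)).@[x 0] = 0).

Section ClassGroup.
Context (L : fieldType) (F : cubic_form L).

Definition G_S := {freeg (surface_point F) / int}.

Definition triple_sums : set G_S :=
  [set D | exists P Q R, collinear_triple P Q R /\
             D = Freeg [:: (1, P)] + Freeg [:: (1, Q)] + Freeg [:: (1, R)]].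

(* G'_S(L): the smallest subgroup containing the sums above. *)
Definition G'_S : set G_S :=
  smallest [set B : set G_S | zmod_closed (fun D : G_S => `[< B D >])]
           triple_sums.

Definition G''_S : {pred G_S} := fun D => `[< G'_S D >] && (deg D == 0).

Fact G''_S_zmod_closed : zmod_closed G''_S.
Proof.
split; first by rewrite unfold_in deg0 eqxx andbT; apply/asboolP => B [[/asboolP]].
move=> x y; rewrite !unfold_in => /andP[/asboolP Gx /eqP dx] /andP[/asboolP Gy /eqP dy].
rewrite degB dx dy subrr eqxx andbT; apply/asboolP => B [[B0 BB] sB].
apply/asboolP/BB; rewrite unfold_in; apply/asboolP.
  exact: (Gx _ (conj (conj B0 BB) sB)).
exact: (Gy _ (conj (conj B0 BB) sB)).
Qed.

HB.instance Definition _ :=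
  GRing.isZmodClosed.Build G_S G''_S G''_S_zmod_closed.

Definition H_S := Quotient.quot G''_S.

Definition degH (d : H_S) : int := deg (repr d).

Lemma degH_pi (D : G_S) : degH (\pi_H_S D) = deg D.
Proof.
apply/eqP; rewrite /degH -subr_eq0 -degB.
have : repr (\pi_H_S D) == D %[mod H_S] by rewrite reprK.
by rewrite -Quotient.idealrBE unfold_in => /andP[].
Qed.

Definition H0_S := {d : H_S | degH d == 0}.

End ClassGroup.

Section ClassGroupBaseChange.
Context (L M : fieldType) (f : {rmorphism L -> M}) (F : cubic_form L).

Definition map_G : G_S F -> G_S (map_cubic f F) :=
  fglift (fun P => Freeg [:: (1, map_point f P)] : G_S (map_cubic f F)).

Fact map_G_is_zmod_morphism : zmod_morphism map_G.
Proof. exact: lift_is_additive. Qed.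

HB.instance Definition _ :=
  GRing.isZmodMorphism.Build _ _ map_G map_G_is_zmod_morphism.

Lemma deg_map_G (D : G_S F) : deg (map_G D) = deg D.
Proof.
rewrite -[D]freeg_sumE raddf_sum /= !(raddf_sum (@deg _)) /=.
apply: eq_bigr => P _.
rewrite /map_G liftU degU; set k := coeff P D; set Q := map_point f P.
suff -> : k *: Freeg [:: (1, Q)] = Freeg [:: (k, Q)] by rewrite degU.
by apply/eqP/freeg_eqP => X; rewrite coeffZ !coeffU mul1r.
Qed.

(* The map induced by map_G: base change respects line cycles and containment of
   lines in S, so the class does not depend on the representative. *)
Definition map_H (d : H_S F) : H_S (map_cubic f F) :=
  \pi_(H_S (map_cubic f F)) (map_G (repr d)).

Fact map_H0_subproof (d : H0_S F) : degH (map_H (val d)) == 0.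
Proof. by rewrite degH_pi deg_map_G; exact: valP d. Qed.

Definition map_H0 (d : H0_S F) : H0_S (map_cubic f F) :=
  exist _ (map_H (val d)) (map_H0_subproof d).

End ClassGroupBaseChange.

Section Places.
Context (R : realType).

Record absolute_value (L : fieldType) (a : L -> R) : Prop := AbsoluteValue {
  abs_ge0 : forall x, 0 <= a x;
  abs_eq0 : forall x, a x = 0 <-> x = 0;
  absM : forall x y, a (x * y) = a x * a y;
  absD : forall x y, a (x + y) <= a x + a y
}.

Definition nonarchimedean (L : fieldType) (a : L -> R) : Prop :=
  forall x y, a (x + y) <= Num.max (a x) (a y).

(* A place is an equivalence class of nontrivial absolute values, a and b being
   equivalent when b = a ^ s for some s > 0. *)
Record place (K : fieldType) := Place {
  place_class : set (K -> R);
  _ : exists a : K -> R,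
        [/\ absolute_value a, exists2 x, x != 0 & a x != 1
          & place_class = [set b | absolute_value b /\
                             exists2 s, 0 < s & forall x, b x = a x `^ s]]
}.

(* A completion of K at v: a complete field in which K embeds densely, with an
   absolute value whose restriction to K belongs to v.  It is unique up to a
   unique homeomorphic isomorphism over K. *)
Record completion (K : fieldType) (v : place K) := Completion {
  completion_field :> fieldType;
  completion_abs : completion_field -> R;
  completion_emb : {rmorphism K -> completion_field};
  completion_absP : absolute_value completion_abs;
  completion_emb_class : place_class v (completion_abs \o completion_emb);
  completion_dense : forall (x : completion_field) (e : R), 0 < e ->
    exists y : K, completion_abs (x - completion_emb y) < e;
  completion_complete : forall u : nat -> completion_field,
    (forall e : R, 0 < e -> exists N, forall m n, (N <= m)%N -> (N <= n)%N ->
       completion_abs (u m - u n) < e) ->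
    exists l, forall e : R, 0 < e -> exists N, forall n, (N <= n)%N ->
       completion_abs (u n - l) < e
}.

End Places.

Section LocalPoints.
Context (R : realType) (K : fieldType) (v : place R K) (Kv : completion v).
Context (F : cubic_form K).

(* S(K_v) *)
Definition local_point := surface_point (map_cubic (completion_emb Kv) F).

HB.instance Definition _ := Choice.on local_point.

(* The v-adic topology: P^3(K_v) carries the quotient topology from
   K_v^4 \ {0}, and S(K_v) the induced one. *)
Definition local_open (U : set local_point) : Prop :=
  forall (P : local_point) (x : 'rV[Kv]_4), U P -> x != 0 -> x \in point_space P ->
  exists2 e : R, 0 < e & forall (Q : local_point) (y : 'rV[Kv]_4),
    y != 0 -> y \in point_space Q ->
    (forall i, completion_abs (y 0 i - x 0 i) < e) -> U Q.

Fact local_openT : local_open setT.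
Proof. by move=> P x _ _ _; exists 1. Qed.

Fact local_openI : setI_closed local_open.
Proof.
move=> U V oU oV P x [UP VP] x0 xP.
have [e e0 He] := oU _ _ UP x0 xP; have [d d0 Hd] := oV _ _ VP x0 xP.
exists (Num.min e d) => [|Q y y0 yQ yx]; first by rewrite lt_min e0.
split; [apply: (He _ y)|apply: (Hd _ y)] => // i.
  by have := yx i; rewrite lt_min => /andP[].
by have := yx i; rewrite lt_min => /andP[].
Qed.

Fact local_open_bigU (I : Type) (f : I -> set local_point) :
  (forall i, local_open (f i)) -> local_open (\bigcup_i f i).
Proof.
move=> of_ P x [i _ fP] x0 xP; have [e e0 He] := of_ i _ _ fP x0 xP.
by exists e => // Q y y0 yQ yx; exists i => //; apply: (He Q y).
Qed.

HB.instance Definition _ := isOpenTopological.Build local_point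
  local_openT local_openI local_open_bigU.

(* For nonarchimedean v, the points of S with values in the valuation ring O_v
   of K_v: those with coordinates in O_v that generate the unit ideal. *)
Definition integral_points : set local_point :=
  [set P | exists x : 'rV[Kv]_4, [/\ x \in point_space P,
             forall i, completion_abs (x 0 i) <= 1
           & exists i, completion_abs (x 0 i) = 1]].

(* Divide the coordinates by one of maximal absolute value. *)
Lemma local_point_integral (P : local_point) : integral_points P.
Proof.
have aP := completion_absP Kv; set a := @completion_abs _ _ _ Kv.
have a_eq0 x : (a x == 0) = (x == 0) by apply/eqP/eqP => /(abs_eq0 aP).
have a_1 : a 1 = 1.
  have /eqP : a 1 * (a 1 - 1) = 0 by rewrite mulrBr -(absM aP) !mulr1 subrr.
  by rewrite mulf_eq0 a_eq0 oner_eq0 subr_eq0 => /eqP.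
set x := vpick (point_space P).
have x0 : x != 0 by rewrite vpick0 -dimv_eq0 (eqP (valP (val P))).
have [j xj] : exists j, x 0 j != 0.
  by apply/existsP; apply: contraR x0 => /existsPn x0;
    apply/eqP/rowP => j; rewrite mxE; apply/eqP/negPn/x0.
case: (@arg_maxP _ _ _ j xpredT (fun i => a (x 0 i)) isT) => i _ xi.
have axi : 0 < a (x 0 i).
  by apply: lt_le_trans (xi j isT); rewrite lt_def a_eq0 xj (abs_ge0 aP).
have xi0 : x 0 i != 0 by rewrite -a_eq0 gt_eqF.
exists ((x 0 i)^-1 *: x); split=> [|k|].
- by rewrite memvZ ?memv_pick.
- rewrite mxE -/a -(ler_pM2l axi) -(absM aP) mulr1 mulVKf //.
  exact: (xi k isT).
- by exists i; rewrite mxE mulVf.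
Qed.

End LocalPoints.

Section AdelicPoints.
Context (R : realType) (K : fieldType).
Context (Kv : forall v : place R K, completion v) (F : cubic_form K).
Context (Sigma : set (place R K)).

(* All but finitely many of the nonarchimedean places outside Sigma; there are
   only finitely many archimedean places. *)
Definition almost_all (A : ~` Sigma -> Prop) : Prop :=
  finite_set [set v : ~` Sigma |
    nonarchimedean (@completion_abs _ _ _ (Kv (set_val v))) /\ ~ A v].

(* S(A_K^Sigma), as the restricted product of the S(K_v) for v outside Sigma
   with respect to the S(O_v). *)
Record adelic_point := AdelicPoint {
  adelic_val :> forall v : ~` Sigma, local_point (Kv (set_val v)) F;
  _ : almost_all (fun v => integral_points (adelic_val v))
}.

HB.instance Definition _ := gen_eqMixin adelic_point.
HB.instance Definition _ := gen_choiceMixin adelic_point.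

(* The products of open sets U_v with U_v = S(O_v) for almost all v.  They are
   stable under finite intersections, so the topology generated below has them
   as a basis: it is the restricted product topology. *)
Definition adelic_boxes : set (set adelic_point) :=
  [set B | exists U : forall v : ~` Sigma, set (local_point (Kv (set_val v)) F),
     [/\ forall v, open (U v),
         almost_all (fun v => U v = @integral_points R K _ (Kv (set_val v)) F)
       & B = [set P : adelic_point | forall v, U v (P v)]]].

HB.instance Definition _ := isSubBaseTopological.Build adelic_point
  adelic_boxes (fun B : set adelic_point => B).

Fact adelic_diagonal_subproof (P : surface_point F) :
  almost_all (fun v => integral_points
    (map_point (completion_emb (Kv (set_val v))) P
       : local_point (Kv (set_val v)) F)).
Proof.
rewrite /almost_all (_ : [set _ | _] = set0) //.
by apply/seteqP; split => // v [_]; case; exact: local_point_integral.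
Qed.

Definition adelic_diagonal (P : surface_point F) : adelic_point :=
  AdelicPoint (adelic_diagonal_subproof P).

End AdelicPoints.

(* Main.v *)
Require Import Defs.
From mathcomp Require Import all_boot all_order all_algebra all_field.
From mathcomp Require Import generic_quotient ring_quotient.
From mathcomp Require Import boolp classical_sets functions cardinality.
From mathcomp Require Import reals exp topology.
From mathcomp Require Import freeg mpoly.
From mathcomp Require Import ring.

(** The theorem follows from weak approximation and one local fact, [good_all]: on
    a smooth cubic surface over a complete valued field of characteristic zero,
    nearby points have the same class in H_S. Granting this, the equivalence
    classes in S(K_v) are open. A class of degree zero at a place v of Delta is a
    combination of differences P - b, with b a fixed point of S(K_v); by density
    there are rational points equivalent to P at v and to base points at the other
    places of Delta, and rational points equivalent to the base points at all
    places of Delta. Their differences lift the class at v and are trivial at the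
    other places ([lift_one_place]), and the lifts for the finitely many places
    are added. That divisors may be mapped to the completion before taking classes
    ([map_H_pi]) is seen by describing a collinear triple as a factorization of
    the restriction of the cubic form to a line ([splits]).

    For the local fact, write the cubic form as F x = T x x x with T trilinear
    and symmetric. Two moves produce equivalent points: the class of the third
    point of a line depends only on those of the other two, and the line through
    R and a point y of the tangent plane section at R gives the triple (R, R,
    y). The tangent lines at a point O meet S again in the points R(t) of a
    parametrized curve, which are all equivalent by the triples (O, O, R(t)).
    Hence the points y of S that lie on the tangent plane at some R(t) are all
    equivalent as well. So it suffices that every y of S near a point p
    satisfies T R(t) R(t) y = 0 for some t, and by the continuity of simple
    roots ([simple_root_continuous], a form of Newton's method that treats all
    absolute values alike) this holds as soon as t is a simple root for p. Such
    a p exists if the tangent plane at R(t) varies with t to first order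
    ([residual_gauss_moves]). If it did not, it would be constant, the curve
    R(t) would be a line, and S would be singular at a point of this line
    defined over a quadratic extension ([gauss_nonconstant]). All this requires
    O to be a point where the tangent plane section is not a cone; such points
    are found by a perturbation ([exists_nonconical_section]).

    One point p near which the class is constant is enough. If q has this property
    and x is a point whose tangent plane does not contain q, with A the third point
    on the line through x and q, then y and the third point of the line through y
    and A determine each other up to equivalence, and the property passes from q
    to x ([good_secant]). As points near p inherit the property, and some of them
    are off any given tangent plane ([leave_tangent_plane]), all points of S have
    it. *)

Set Implicit Arguments.
Unset Strict Implicit.
Unset Printing Implicit Defensive.

Import Order.TTheory GRing.Theory Num.Theory.
Local Open Scope classical_set_scope.
Local Open Scope quotient_scope.
Local Open Scope ring_scope.

(** * Symmetric trilinear forms on a space of dimension 4 *)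

Definition tensor (R : Type) := 'I_4 -> 'I_4 -> 'I_4 -> R.

Definition tmap (R S : Type) (f : R -> S) (c : tensor R) : tensor S :=
  fun i j k => f (c i j k).

Definition symmetric3 (R : Type) (c : tensor R) :=
  (forall i j k, c i j k = c j i k) /\ (forall i j k, c i j k = c i k j).

Section Trilinear.
Context (R : comNzRingType) (c : tensor R).
Implicit Types (x y z : 'rV[R]_4) (a : R).

Definition tri x y z : R :=
  \sum_i \sum_j \sum_k c i j k * (x 0 i * y 0 j * z 0 k).

Definition cub x : R := tri x x x.

Lemma triD1 x x' y z : tri (x + x') y z = tri x y z + tri x' y z.
Proof.
rewrite /tri -big_split; apply: eq_bigr => i _ /=; rewrite -big_split.
apply: eq_bigr => j _ /=; rewrite -big_split; apply: eq_bigr => k _ /=.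
by rewrite mxE; ring.
Qed.

Lemma triZ1 a x y z : tri (a *: x) y z = a * tri x y z.
Proof.
rewrite /tri mulr_sumr; apply: eq_bigr => i _; rewrite mulr_sumr.
apply: eq_bigr => j _; rewrite mulr_sumr; apply: eq_bigr => k _.
by rewrite mxE; ring.
Qed.

Hypothesis sc : symmetric3 c.

Lemma triC12 x y z : tri x y z = tri y x z.
Proof.
rewrite /tri exchange_big; apply: eq_bigr => i _; apply: eq_bigr => j _.
by apply: eq_bigr => k _; rewrite sc.1 [x 0 j * _]mulrC.
Qed.

Lemma triC23 x y z : tri x y z = tri x z y.
Proof.
rewrite /tri; apply: eq_bigr => i _; rewrite exchange_big.
apply: eq_bigr => j _; apply: eq_bigr => k _.
by rewrite sc.2 -!mulrA [y 0 k * _]mulrC.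
Qed.

Lemma triC13 x y z : tri x y z = tri z y x.
Proof. by rewrite triC12 triC23 triC12. Qed.

Lemma triD2 x y y' z : tri x (y + y') z = tri x y z + tri x y' z.
Proof. by rewrite !(triC12 x) triD1. Qed.

Lemma triD3 x y z z' : tri x y (z + z') = tri x y z + tri x y z'.
Proof. by rewrite !(triC23 x y) triD2. Qed.

Lemma triZ2 a x y z : tri x (a *: y) z = a * tri x y z.
Proof. by rewrite !(triC12 x) triZ1. Qed.

Lemma triZ3 a x y z : tri x y (a *: z) = a * tri x y z.
Proof. by rewrite !(triC23 x y) triZ2. Qed.

Lemma triN1 x y z : tri (- x) y z = - tri x y z.
Proof. by rewrite -scaleN1r triZ1 mulN1r. Qed.

Lemma triN2 x y z : tri x (- y) z = - tri x y z.
Proof. by rewrite -scaleN1r triZ2 mulN1r. Qed.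

Lemma triN3 x y z : tri x y (- z) = - tri x y z.
Proof. by rewrite -scaleN1r triZ3 mulN1r. Qed.

Lemma tri03 x y : tri x y (0 : 'rV[R]_4) = 0.
Proof. by rewrite -(scale0r (0 : 'rV[R]_4)) triZ3 mul0r. Qed.

Lemma tri_row3 x y z : tri x y z = \sum_k z 0 k * tri x y (delta_mx 0 k).
Proof.
rewrite {1}[z]row_sum_delta.
rewrite (big_morph (tri x y) (fun v w => triD3 x y v w) (tri03 x y)).
by apply: eq_bigr => k _; rewrite triZ3.
Qed.

Definition triE := (triD1, triD2, triD3, triZ1, triZ2, triZ3,
  (triN1, triN2, triN3)).

Lemma tri_pencil2 s t u w v : tri (s *: u + t *: w) (s *: u + t *: w) v =
  s ^+ 2 * tri u u v + 2 * s * t * tri u w v + t ^+ 2 * tri w w v.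
Proof. by rewrite !triE (triC12 w u); ring. Qed.

Lemma cub_pencil s t u w : cub (s *: u + t *: w) =
  s ^+ 3 * cub u + 3 * (s ^+ 2 * t) * tri u u w +
  3 * (s * t ^+ 2) * tri u w w + t ^+ 3 * cub w.
Proof.
rewrite /cub tri_pencil2 !triE (triC13 w w u) (triC23 u w u).
rewrite (triC12 u w w) (triC23 w u w); ring.
Qed.

Lemma cubZ a x : cub (a *: x) = a ^+ 3 * cub x.
Proof. by rewrite /cub !triE; ring. Qed.

Lemma tri_polar x y z : 6 * tri x y z = cub (x + y + z) - cub (x + y) -
  cub (x + z) - cub (y + z) + cub x + cub y + cub z.
Proof.
rewrite /cub !triE.
rewrite (triC12 z x y) (triC23 x z y) (triC12 y z x) (triC13 z y x).
rewrite (triC12 y x z) ?(triC12 y x x) ?(triC12 z x x) ?(triC12 z y y).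
rewrite ?(triC23 x y x) ?(triC12 y x x) ?(triC23 x z x) ?(triC12 z x x).
rewrite ?(triC23 y x y) ?(triC23 z x z) ?(triC23 z y z) ?(triC23 y z y).
rewrite ?(triC12 z y y) ?(triC12 x y y) ?(triC12 x z z) ?(triC12 y z z).
ring.
Qed.

End Trilinear.

Lemma tri_map (R S : comNzRingType) (f : {rmorphism R -> S}) (c : tensor R)
    (x y z : 'rV[R]_4) :
  tri (tmap f c) (map_mx f x) (map_mx f y) (map_mx f z) = f (tri c x y z).
Proof.
rewrite /tri rmorph_sum; apply: eq_bigr => i _; rewrite rmorph_sum.
apply: eq_bigr => j _; rewrite rmorph_sum; apply: eq_bigr => k _.
by rewrite !mxE /tmap !rmorphM.
Qed.

Lemma symmetric3_map (R S : Type) (f : R -> S) (c : tensor R) :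
  symmetric3 c -> symmetric3 (tmap f c).
Proof. by case=> c12 c23; split=> i j k;
  [exact: congr1 (c12 _ _ _)|exact: congr1 (c23 _ _ _)]. Qed.

(** * Cubic forms as diagonals of trilinear forms *)

Definition tensor_form (R : comNzRingType) (c : tensor R) : {mpoly R[4]} :=
  \sum_i \sum_j \sum_k c i j k *: ('X_i * 'X_j * 'X_k).

Section TensorForm.
Context (R : comNzRingType) (c : tensor R).

Lemma meval_tensor_form (x : 'rV[R]_4) : (tensor_form c).@[x 0] = cub c x.
Proof.
rewrite /tensor_form raddf_sum; apply: eq_bigr => i _; rewrite raddf_sum.
apply: eq_bigr => j _; rewrite raddf_sum; apply: eq_bigr => k _.
by rewrite /= mevalZ !mevalM !mevalXU.
Qed.

Hypothesis sc : symmetric3 c.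

Lemma meval_mderiv_tensor_form (x : 'rV[R]_4) l :
  ((tensor_form c)^`M(l)).@[x 0] = 3 * tri c x x (delta_mx 0 l).
Proof.
have -> : 3 * tri c x x (delta_mx 0 l) =
    tri c (delta_mx 0 l) x x + tri c x (delta_mx 0 l) x +
    tri c x x (delta_mx 0 l).
  rewrite (triC13 sc (delta_mx 0 l)) (triC23 sc x (delta_mx 0 l)); ring.
have dX i : ('X_i : {mpoly R[4]})^`M(l) = ((i == l)%:R)%:MP.
  rewrite mderivX mnm1E; case: eqVneq => [->|_]; rewrite ?scale0r ?scale1r //.
  by rewrite -[X in (X - _)%MM]addm0 addmC addmK mpolyX0 mpolyC1.
rewrite /tensor_form /tri -!big_split (linear_sum (mderiv l)) raddf_sum; apply: eq_bigr => i _.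
rewrite -!big_split (linear_sum (mderiv l)) raddf_sum; apply: eq_bigr => j _.
rewrite -!big_split (linear_sum (mderiv l)) raddf_sum; apply: eq_bigr => k _.
rewrite /= mderivZ !mderivM !dX !(mevalZ, mevalD, mevalM, mevalXU, mevalC).
rewrite !mxE !eqxx /=; ring.
Qed.

End TensorForm.

Lemma map_tensor_form (R S : comNzRingType) (f : {rmorphism R -> S})
  (c : tensor R) : map_mpoly f (tensor_form c) = tensor_form (tmap f c).
Proof.
rewrite /tensor_form raddf_sum; apply: eq_bigr => i _; rewrite raddf_sum.
apply: eq_bigr => j _; rewrite raddf_sum; apply: eq_bigr => k _.
by rewrite /= map_mpolyZ !rmorphM /= !map_mpolyX.
Qed.

Lemma mnm_deg3 n (m : 'X_{1..n}) : mdeg m = 3%N ->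
  exists t : 'I_n * 'I_n * 'I_n, m = (U_(t.1.1) + U_(t.1.2) + U_(t.2))%MM.
Proof.
have split1 d (q : 'X_{1..n}) :
    mdeg q = d.+1 -> exists i q', q = (U_(i) + q')%MM /\ mdeg q' = d.
  move=> qd; have [i qi] : exists i, q i != 0%N.
    apply/existsP; apply: contra_eqT qd => /existsPn q0.
    by rewrite mdegE big1 // => i _; apply/eqP/negPn/q0.
  have eq : q = (U_(i) + (q - U_(i)))%MM.
    apply/mnmP => j; rewrite mnmDE mnmBE mnm1E addnC subnK //.
    by case: eqP => // <-; rewrite lt0n.
  exists i, (q - U_(i))%MM; split=> //.
  by move: qd; rewrite eq mdegD mdeg1 -eq => -[].
move=> /split1[i [q [-> /split1[j [r [-> /split1[k [s [-> ]]]]]]]]].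
by move=> /eqP; rewrite mdeg_eq0 => /eqP ->; exists (i, j, k); rewrite addm0 addmA.
Qed.

(** The coefficient of a monomial is shared equally among the ordered triples of
    variables whose product is this monomial; the number of these triples can be
    inverted in characteristic zero. *)
Lemma cubic_tensor (L : fieldType) (F : cubic_form L) :
  [pchar L] =i pred0 ->
  exists2 c : tensor L, symmetric3 c & (F : {mpoly L[4]}) = tensor_form c.
Proof.
move=> /pcharf0P L0.
pose mon (t : 'I_4 * 'I_4 * 'I_4) := (U_(t.1.1) + U_(t.1.2) + U_(t.2))%MM.
pose cnt m := #|[pred t | mon t == m]|.
pose e m : L := (F : {mpoly L[4]})@_m / (cnt m)%:R.
exists (fun i j k => e (mon (i, j, k))).
  by split=> i j k; congr e; apply/mnmP => l; rewrite !mnmDE /=;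
    [rewrite [X in (X + _)%N]addnC|rewrite addnAC].
apply/mpolyP => m.
have -> : tensor_form (fun i j k => e (mon (i, j, k))) =
    \sum_t e (mon t) *: 'X_[mon t].
  rewrite /tensor_form pair_bigA pair_bigA /=; apply: eq_bigr => -[[i j] k] _.
  by rewrite /mon /= !mpolyXD.
rewrite raddf_sum /= (eq_bigr (fun t => if mon t == m then e m else 0)); last first.
  move=> t _; rewrite mcoeffZ mcoeffX.
  by case: eqP => [->|_]; rewrite (mulr1, mulr0).
rewrite -big_mkcond /= sumr_const.
rewrite -/(cnt m).
have [m3|m3] := eqVneq (mdeg m) 3%N.
  have [t mt] := mnm_deg3 m3.
  have c0 : (0 < cnt m)%N by apply/card_gt0P; exists t; rewrite inE mt.
  by rewrite -mulr_natr /e divfK // L0 -lt0n.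
suff -> : e m = 0 :> L.
  rewrite mul0rn; apply: memN_msupp_eq0; apply: contraNN m3 => mF.
  by have /dhomogP/(_ _ mF)/= -> := dhomog_is_dhomog F.
rewrite /e memN_msupp_eq0 ?mul0r //; apply: contraNN m3 => mF.
by have /dhomogP/(_ _ mF)/= -> := dhomog_is_dhomog F.
Qed.

(** * Tangent planes of a smooth cubic surface *)

(** Smoothness in terms of the trilinear form T: the functional T x x _ is, up to
    the factor 3, the differential of the cubic form at x, so that its kernel is
    the tangent plane at x when x is on the surface. *)
Definition nonsingular (L : fieldType) (c : tensor L) :=
  forall (M : fieldType) (f : {rmorphism L -> M}) (x : 'rV[M]_4), x != 0 ->
    exists v, tri (tmap f c) x x v != 0.

Definition indep (L : fieldType) (u w : 'rV[L]_4) :=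
  forall s t : L, s *: u + t *: w = 0 -> s = 0 /\ t = 0.

Lemma nonsingular_map (L M : fieldType) (f : {rmorphism L -> M})
  (c : tensor L) : nonsingular c -> nonsingular (tmap f c).
Proof. by move=> nc N g x x0; have [v] := nc N (g \o f) x x0; exists v. Qed.

Lemma smooth_nonsingular (L : fieldType) (F : cubic_form L) (c : tensor L) :
  symmetric3 c -> (F : {mpoly L[4]}) = tensor_form c ->
  smooth F -> nonsingular c.
Proof.
move=> sc Fc sF M f x x0; apply: contrapT => /forallNP tri0.
have {}tri0 v : tri (tmap f c) x x v = 0 by apply/eqP/negPn/negP/tri0.
apply: (sF M f x x0); rewrite /= Fc map_tensor_form meval_tensor_form.
split=> [|i]; first exact: tri0.
by rewrite meval_mderiv_tensor_form ?tri0 ?mulr0 //; exact: symmetric3_map.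
Qed.

Lemma quadratic_root (L : fieldType) (p : {poly L}) : size p = 3%N ->
  exists (M : fieldType) (f : {rmorphism L -> M}) (z : M), root (map_poly f p) z.
Proof.
move=> p3; have [[z pz]|nroot] := pselect (exists z, root p z).
  by exists L, idfun, z; rewrite map_poly_id.
have pirr : irreducible_poly p.
  by apply: cubic_irreducible => [|z]; [rewrite p3|apply/negP => pz; apply: nroot; exists z].
by have [M _ [z pz _]] := irredp_FAdjoin pirr; exists M, (in_alg M), z.
Qed.

Section Algebra.
Context (L : fieldType) (c : tensor L).
Hypothesis sc : symmetric3 c.
Local Notation T := (tri c).
Implicit Types (x y z u v w : 'rV[L]_4).

Lemma indep_row_free u w : indep u w -> row_free (col_mx u w).
Proof.
move=> iuw; apply/inj_row_free => v.
rewrite -[v]hsubmxK mul_row_col [lsubmx v]mx11_scalar [rsubmx v]mx11_scalar.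
rewrite !mul_scalar_mx => /iuw[-> ->].
by rewrite raddf0; apply/rowP => i; rewrite !mxE; case: splitP => j; rewrite mxE.
Qed.

Lemma indep_sym u w : indep u w -> indep w u.
Proof. by move=> i s t; rewrite addrC => /i[-> ->]. Qed.

Lemma indep_neq0l u w : indep u w -> u != 0.
Proof.
move=> iuw; apply/eqP => u0; have := iuw 1 0.
by rewrite u0 scaler0 scale0r addr0 => /(_ erefl)[/eqP]; rewrite oner_eq0.
Qed.

Lemma indep_neq0r u w : indep u w -> w != 0.
Proof. by move/indep_sym/indep_neq0l. Qed.

Lemma indepPn u w : u != 0 -> (forall s, w != s *: u) -> indep u w.
Proof.
move=> u0 wu s t; have [-> /eqP|t0 /eqP] := eqVneq t 0.
  by rewrite scale0r addr0 scaler_eq0 (negPf u0) orbF => /eqP.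
rewrite addr_eq0 -scaleNr => /eqP suw.
have /negP[] := wu (- t^-1 * s).
by rewrite -scalerA suw scalerA mulrNN mulVf // scale1r.
Qed.

Hypothesis nc : nonsingular c.

Lemma gauss_neq0 x : x != 0 -> exists v, T x x v != 0.
Proof. exact: (nc idfun). Qed.

(** The hypotheses say that along the line through u and w the differential of
    the cubic form is the fixed functional l multiplied by a binary quadratic
    form. Over an extension of degree at most 2 this quadratic form has a root,
    and there the surface would be singular. *)
Lemma gauss_nonconstant u w (l : 'rV[L]_4 -> L) (q0 q1 q2 : L) : indep u w ->
  (forall v, T u u v = q0 * l v) -> (forall v, 2 * T u w v = q1 * l v) ->
  (forall v, T w w v = q2 * l v) -> False.
Proof.
move=> iuw E0 E1 E2; have q2N0 : q2 != 0.
  have [v] := gauss_neq0 (indep_neq0r iuw).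
  by rewrite E2; apply: contraNneq => ->; rewrite mul0r.
have sz : size (Poly [:: q0; q1; q2]) = 3%N by rewrite (@PolyK _ 0).
have [M [f [z]]] := quadratic_root sz.
rewrite map_Poly_id0 ?rmorph0 // /root. rewrite horner_Poly /= => /eqP pz.
pose x := map_mx f u + z *: map_mx f w.
have x0 : x != 0.
  have := indep_row_free iuw; rewrite -(row_free_map f) map_col_mx => fr.
  have -> : x = row_mx 1 z%:M *m col_mx (map_mx f u) (map_mx f w).
    by rewrite mul_row_col mul1mx mul_scalar_mx.
  rewrite mulmx_free_eq0 //; apply/eqP => /(congr1 lsubmx).
  by rewrite row_mxKl raddf0 => /eqP; rewrite oner_eq0.
have sM : symmetric3 (tmap f c) by exact: symmetric3_map.
have [v /negP[]] := nc f x0.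
suff d k : tri (tmap f c) x x (delta_mx 0 k) = 0.
  by rewrite tri_row3 // big1 // => k _; rewrite d mulr0.
rewrite -(map_delta_mx f) /x -[map_mx f u]scale1r tri_pencil2 //.
rewrite !tri_map expr1n mul1r mulr1 E0 E2.
have -> : 2 * z * f (T u w (delta_mx 0 k)) = z * f (2 * T u w (delta_mx 0 k)).
  by rewrite rmorphM rmorph_nat mulrCA mulrA.
rewrite E1 !rmorphM; set lk := f (l _).
transitivity (lk * (((0 * z + f q2) * z + f q1) * z + f q0)).
  by ring.
by rewrite pz mulr0.
Qed.

Hypothesis L0 : [pchar L] =i pred0.

Lemma natf_neq0_char0 n : (n.+1%:R : L) != 0.
Proof. by have /pcharf0P -> := L0. Qed.

(** Were the cubic form zero on the plane [T x x _ = 0], polarization would make T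
    vanish on triples of vectors of this plane. All the differentials at points of
    the plane would then be multiples of the functional T x x _, which
    [gauss_nonconstant] excludes on any line of the plane. *)
Lemma tangent_plane_off x : x != 0 -> exists w, T x x w = 0 /\ cub c w != 0.
Proof.
move=> x0; apply: contrapT => /forallNP H.
have {}H w : T x x w = 0 -> cub c w = 0.
  by move=> w0; apply/eqP/negPn/negP => w1; apply: (H w).
have planeD u v : T x x u = 0 -> T x x v = 0 -> T x x (u + v) = 0.
  by move=> u0 v0; rewrite triD3 // u0 v0 addr0.
have plane3 u v w : T x x u = 0 -> T x x v = 0 -> T x x w = 0 -> T u v w = 0.
  move=> u0 v0 w0; apply: (mulfI (natf_neq0_char0 5)).
  rewrite tri_polar // !H ?planeD //; ring.
have [j lj] : exists j, T x x (delta_mx 0 j) != 0.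
  have [v] := gauss_neq0 x0; apply: contraNP => /forallNP Hj.
  rewrite tri_row3 // big1 // => k _.
  by have /negP/negPn/eqP -> := Hj k; rewrite mulr0.
set d := fun k : 'I_4 => delta_mx 0 k : 'rV[L]_4.
pose m (i : 'I_3) := T x x (d j) *: d (fintype.lift j i) - T x x (d (fintype.lift j i)) *: d j.
have m0 i : T x x (m i) = 0 by rewrite !triE //; ring.
have lE u w v : T x x u = 0 -> T x x w = 0 ->
    T u w v = T u w (d j) / T x x (d j) * T x x v.
  move=> u0 w0; have : T u w (T x x (d j) *: v - T x x v *: d j) = 0.
    by apply: plane3 => //; rewrite !triE //; ring.
  rewrite !triE // => /eqP; rewrite subr_eq0 => /eqP E; apply: (mulfI lj).
  by rewrite E; field.
have i01 : indep (m 0) (m 1).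
  move=> s t /rowP E; have := E (fintype.lift j 0); have := E (fintype.lift j 1).
  rewrite !mxE !eqxx /= ![_ == j]eq_sym !(negPf (neq_lift _ _)) /=.
  rewrite !(inj_eq (@lift_inj _ j)) /= !(mulr0, subr0, oppr0, add0r, addr0, mulr1).
  by move=> /eqP + /eqP; rewrite !mulf_eq0 (negPf lj) !orbF => /eqP -> /eqP ->.
apply: (@gauss_nonconstant (m 0) (m 1) (T x x) _ _ _ i01).
- by move=> v; apply: lE.
- by move=> v; rewrite (lE _ _ v) // mulrA.
- by move=> v; apply: lE.
Qed.

(** The plane [T x x _ = 0] has dimension 3 as a vector space, so it is not spanned
    by x and b. *)
Lemma tangent_plane_third x b : exists a,
  T x x a = 0 /\ forall s t, a != s *: x + t *: b.
Proof.
pose N : 'cV[L]_4 := \col_k T x x (delta_mx 0 k).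
have NE v : T x x v = (v *m N) 0 0.
  by rewrite tri_row3 // mxE; apply: eq_bigr => k _; rewrite mxE.
have : ~~ (kermx N <= col_mx x b)%MS.
  apply/negP => /mxrankS; rewrite mxrank_ker leqNgt => /negP[].
  apply: leq_ltn_trans (rank_leq_row _) _.
  by rewrite ltn_subRL (leq_ltn_trans (_ : _ <= 3)%N) // (leq_add2r _ _ 1) // rank_leq_col.
case/row_subPn => i Hi; exists (row i (kermx N)); split.
  rewrite NE; have /sub_kermxP -> : (row i (kermx N) <= kermx N)%MS by exact: row_sub.
  by rewrite mxE.
move=> s t; apply: contraNneq Hi => ->.
have -> : s *: x + t *: b = row_mx s%:M t%:M *m col_mx x b.
  by rewrite mul_row_col !mul_scalar_mx.
exact: submxMl.
Qed.

Lemma natr_inj_char0 : injective (fun n => n%:R : L).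
Proof.
move=> m n /=; wlog lemn : m n / (m <= n)%N => [H|].
  by case/orP: (leq_total m n) => [/H//|/H + E] => /(_ (esym E)).
move=> /esym/eqP; rewrite -subr_eq0 -natrB //.
by have /pcharf0P -> := L0; rewrite subn_eq0 => h; apply/eqP; rewrite eqn_leq lemn.
Qed.

Lemma poly_nonroot (p : {poly L}) : p != 0 -> exists t, p.[t] != 0.
Proof.
move=> p0; apply: contrapT => /forallNP H.
have /(max_poly_roots p0) : all (root p) [seq n%:R | n <- iota 0 (size p)].
  by apply/allP => x _; apply/negPn/negP/H.
rewrite map_inj_uniq ?iota_uniq; last exact: natr_inj_char0.
by rewrite size_map size_iota ltnn => /(_ isT).
Qed.

Lemma size_deriv_char0 (p : {poly L}) : size p^`() = (size p).-1.
Proof.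
case sp: (size p) => [|[|n]].
- by move/eqP: sp; rewrite size_poly_eq0 => /eqP ->; rewrite deriv0 size_poly0.
- by have /size_poly1P[k _ ->] : size p == 1%N; [rewrite sp|rewrite derivC size_poly0].
apply/eqP; rewrite eqn_leq -ltnS -[X in (_ < X)%N]sp lt_size_deriv -?size_poly_gt0 ?sp //=.
rewrite ltnNge; apply/negP => /leq_sizeP/(_ n (leqnn n))/eqP.
rewrite coef_deriv -mulr_natr mulf_eq0 (negPf (natf_neq0_char0 n)) orbF.
by rewrite -[n.+1]/(n.+2.-1) -sp -lead_coefE lead_coef_eq0 -size_poly_eq0 sp.
Qed.

Lemma lead_coef_deriv_char0 (p : {poly L}) :
  lead_coef p^`() = lead_coef p *+ (size p).-1.
Proof.
rewrite lead_coefE size_deriv_char0 coef_deriv lead_coefE.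
case sp: (size p) => [|[|n]] //=; by rewrite mulr0n nth_default // sp.
Qed.

(** In characteristic zero the leading coefficients of the two products force A
    and B to have the same degree; a multiple of B that cancels the leading term
    of A leaves a polynomial of smaller degree to which induction applies. *)
Lemma wronskian_eq0 (A B : {poly L}) :
  B != 0 -> A^`() * B = A * B^`() -> exists k, A = k *: B.
Proof.
move=> B0; have [n] := ubnP (size A); elim: n A => // n IHn A sA E.
have [->|A0] := eqVneq A 0; first by exists 0; rewrite scale0r.
have sAB : size A = size B.
  have [lA lB] : lead_coef A != 0 /\ lead_coef B != 0 by rewrite !lead_coef_eq0.
  have := congr1 lead_coef E; rewrite !lead_coefM !lead_coef_deriv_char0.
  rewrite mulrnAl mulrnAr => /eqP.
  rewrite -mulr_natr -[X in _ == X]mulr_natr.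
  rewrite (inj_eq (mulfI (mulf_neq0 lA lB))) (inj_eq natr_inj_char0).
  rewrite eq_sym => /eqP e.
  by rewrite -(prednK (_ : 0 < size A)%N) ?size_poly_gt0 // -e prednK ?size_poly_gt0.
have lB : lead_coef B != 0 by rewrite lead_coef_eq0.
pose k := lead_coef A / lead_coef B.
have [||k' Ek] := IHn (A - k *: B).
- apply: leq_trans (_ : (size A <= n)%N); last by rewrite -ltnS.
  have k0 : k != 0 by rewrite mulf_neq0 ?invr_eq0 ?lead_coef_eq0.
  rewrite -(prednK (_ : 0 < size A)%N) ?size_poly_gt0 // ltnS.
  apply/leq_sizeP => i; rewrite leq_eqVlt => /orP[/eqP<-|iA].
    by rewrite coefB coefZ {2}sAB -!lead_coefE divfK ?subrr.
  rewrite coefB coefZ !nth_default ?mulr0 ?subrr //; first rewrite -sAB.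
    by rewrite -(prednK (_ : 0 < size A)%N) ?size_poly_gt0.
  by rewrite -(prednK (_ : 0 < size A)%N) ?size_poly_gt0.
- by rewrite derivB derivZ !mulrBl E -!scalerAl [B^`() * _]mulrC.
by exists (k' + k); rewrite scalerDl -Ek subrK.
Qed.

End Algebra.

(** * The residual curve of a tangent plane section *)

Section TangentCurve.
Context (L : fieldType) (c : tensor L).
Hypothesis sc : symmetric3 c.
Local Notation T := (tri c).
Local Notation cP := (tmap polyC c).
Local Notation TP := (tri cP).
Local Notation vP := (map_mx polyC).
Local Notation ev t := (map_mx (horner_eval t)).

Let scP : symmetric3 cP. Proof. exact: symmetric3_map. Qed.

Lemma horner_tri t x y z : (TP x y z).[t] = T (ev t x) (ev t y) (ev t z).
Proof.
rewrite -[LHS]/(horner_eval t (TP x y z)) -tri_map; congr (tri _ _ _ _).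
apply/funext => i; apply/funext => j; apply/funext => k.
exact: hornerC.
Qed.

Lemma ev_polyC t (x : 'rV[L]_4) : ev t (vP x) = x.
Proof. by apply/rowP => i; rewrite !mxE /horner_eval hornerC. Qed.

Lemma tri_polyC x y z : TP (vP x) (vP y) (vP z) = (T x y z)%:P.
Proof. exact: tri_map. Qed.

Lemma deriv_tri (x y z : 'rV[{poly L}]_4) : (TP x y z)^`() =
  TP (map_mx deriv x) y z + TP x (map_mx deriv y) z + TP x y (map_mx deriv z).
Proof.
rewrite /tri -!big_split raddf_sum; apply: eq_bigr => i _.
rewrite -!big_split raddf_sum; apply: eq_bigr => j _.
rewrite -!big_split raddf_sum; apply: eq_bigr => k _ /=.
rewrite !derivM derivC !mxE; ring.
Qed.

Lemma deriv_polyC (x : 'rV[L]_4) : map_mx deriv (vP x) = 0.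
Proof. by apply/rowP => i; rewrite !mxE derivC. Qed.

Definition line_param (a b : 'rV[L]_4) : 'rV[{poly L}]_4 := vP a + 'X *: vP b.

Lemma ev_line_param t a b : ev t (line_param a b) = a + t *: b.
Proof. by apply/rowP => i; rewrite !mxE /horner_eval !hornerE. Qed.

(** Coordinates of the third point, besides O counted twice, of the intersection of
    the surface with the line through O and a + tb, for a and b in the tangent plane
    at O. *)
Definition residual (O a b : 'rV[L]_4) : 'rV[{poly L}]_4 :=
  let d := line_param a b in cub cP d *: vP O - (3 * TP (vP O) d d) *: d.

Lemma tri_line_param a b v : TP (line_param a b) (line_param a b) (vP v) =
  (T a a v)%:P + (2 * T a b v)%:P * 'X + (T b b v)%:P * 'X^2.
Proof.
rewrite /line_param -[vP a]scale1r tri_pencil2 // !tri_polyC.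
rewrite expr1n mul1r mulr1 [RHS]addrAC -!addrA; congr (_ + _).
rewrite [RHS]addrC; congr (_ + _); last exact: mulrC.
by rewrite polyCM -[2%:P]/(2%:R%:P) polyC_natr; ring.
Qed.

Section Residual.
Context (O a b : 'rV[L]_4).
Hypotheses (O0 : cub c O = 0) (Oa : T O O a = 0) (Ob : T O O b = 0).
Local Notation d := (line_param a b).
Local Notation R := (residual O a b).

Lemma tri_OOd : TP (vP O) (vP O) d = 0.
Proof. by rewrite /line_param !triE // !tri_polyC Oa Ob !polyC0; ring. Qed.

Lemma cub_residual : cub cP R = 0.
Proof.
rewrite /residual -scaleNr cub_pencil // tri_OOd.
have -> : cub cP (vP O) = 0 by rewrite /cub tri_polyC [T _ _ _]O0.
ring.
Qed.

Lemma tri_residual : TP R R (vP O) = 9 * TP (vP O) d d ^+ 3.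
Proof.
rewrite /residual -scaleNr tri_pencil2 // [TP (vP O) d (vP O)]triC23 // tri_OOd.
have -> : TP (vP O) (vP O) (vP O) = 0 by rewrite tri_polyC [T _ _ _]O0.
rewrite (triC13 scP d d); ring.
Qed.

Hypotheses (nc : nonsingular c) (L0 : [pchar L] =i pred0).
Hypotheses (Obb : T O b b != 0) (aOb : forall s t, a != s *: O + t *: b).

Lemma tri_Odd : TP (vP O) d d = (T O a a)%:P + (2 * T O a b)%:P * 'X +
  (T O b b)%:P * 'X^2.
Proof.
rewrite (triC13 scP) tri_line_param; congr (_%:P + _%:P * _ + _%:P * _).
- by rewrite (triC13 sc).
- by rewrite (triC13 sc a) (triC23 sc O b).
- by rewrite (triC13 sc).
Qed.

Lemma tri_Odd_neq0 : TP (vP O) d d != 0.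
Proof.
apply: contraNneq Obb => /(congr1 (fun p : {poly L} => p`_2)).
by rewrite tri_Odd !coefD coefC !coefCM coefX coefXn coef0 /= mulr0 mulr1 !add0r => ->.
Qed.

Lemma natf_poly_neq0 n : (n.+1%:R : {poly L}) != 0.
Proof. by rewrite -polyC_natr polyC_eq0 natf_neq0_char0. Qed.

Lemma line_param_indep (k l : L) : indep (k *: O - a) (l *: O - b).
Proof.
move=> s t E.
have {}E : s *: a = (s * k + t * l) *: O + (- t) *: b.
  apply/eqP; rewrite -subr_eq0 -oppr_eq0; apply/eqP; rewrite -[RHS]E.
  by apply/rowP => i; rewrite !mxE; ring.
have s0 : s = 0.
  apply/eqP; apply: contraT => s0.
  have /negP[] := aOb (s^-1 * (s * k + t * l)) (s^-1 * - t).
  by rewrite -!scalerA -scalerDr -E scalerA mulVf // scale1r.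
split=> //; apply/eqP; apply: contraT => t0.
move: E; rewrite s0 scale0r mul0r add0r scaleNr -scalerA -scalerBr => /esym/eqP.
rewrite scaler_eq0 (negPf t0) subr_eq0 /= => /eqP bE.
by move: Obb; rewrite -bE triZ2 // triZ3 // [T O O O]O0 !mulr0 eqxx.
Qed.

Lemma residual_line_param (k l : L) :
  cub cP d = 3 * TP (vP O) d d * (k%:P + 'X * l%:P) ->
  R = (3 * TP (vP O) d d) *: line_param (k *: O - a) (l *: O - b).
Proof.
move=> gE; rewrite /residual gE -scalerA -scalerBr; congr (_ *: _).
by apply/rowP => i; rewrite !mxE !polyCB !polyCM; ring.
Qed.

Lemma tri_line_param_coef (u w v : 'rV[L]_4) (k : L) :
  TP (line_param u w) (line_param u w) (vP v) = k%:P * TP (vP O) d d ->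
  [/\ T u u v = T O a a * k, 2 * T u w v = 2 * T O a b * k &
    T w w v = T O b b * k].
Proof.
rewrite tri_line_param tri_Odd => /polyP E.
split; [move: (E 0)|move: (E 1)|move: (E 2)];
  rewrite !coefCM !coefD !coefCM !coefC coefX coefXn /=.
- by rewrite !mulr0 !addr0 [RHS]mulrC.
- by rewrite !mulr0 !mulr1 !addr0 !add0r [RHS]mulrC.
- by rewrite !mulr0 !mulr1 !addr0 !add0r [RHS]mulrC.
Qed.

(** If the tangent plane did not move to first order along the residual curve, the
    coefficients N v of its equation would have vanishing Wronskians with N O, and
    the tangent planes would all coincide. As N O = 9 q ^+ 3 is not zero, O is not
    on this common plane, so that the curve is the line in which the common plane
    meets the tangent plane at O; this contradicts [gauss_nonconstant]. *)
Lemma residual_gauss_moves : exists t v, (TP (vP O) d d).[t] != 0 /\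
  (TP R R (vP O) * (TP R R (vP v))^`() -
   (TP R R (vP O))^`() * TP R R (vP v)).[t] != 0.
Proof.
set N := fun v => TP R R (vP v).
suff [v Wv] : exists v, N O * (N v)^`() - (N O)^`() * N v != 0.
  have [t] := poly_nonroot L0 (mulf_neq0 tri_Odd_neq0 Wv).
  by rewrite hornerM mulf_eq0 negb_or => /andP[q0 W0]; exists t, v.
apply: contrapT => /forallNP W0.
have NO : N O = 9 * TP (vP O) d d ^+ 3 := tri_residual.
have q0 : TP (vP O) d d != 0 := tri_Odd_neq0.
have three0 : 3 != 0 :> {poly L} := natf_poly_neq0 2.
have NO0 : N O != 0.
  by rewrite NO mulf_neq0 ?expf_neq0 // (natf_poly_neq0 8).
have /choice[k Nk] v : exists k, N v = k *: N O.
  apply: (wronskian_eq0 L0 NO0); apply/eqP; rewrite mulrC -subr_eq0 [N v * _]mulrC.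
  exact/negPn/negP/W0.
have gE : cub cP d = 3 * TP (vP O) d d * ((k a)%:P + 'X * (k b)%:P).
  have := cub_residual; rewrite {1}/cub {3}/residual -scaleNr.
  rewrite triD3 // !triZ3 // [TP R R d]triD3 // triZ3 //.
  rewrite -/(N O) -/(N a) -/(N b) (Nk a) (Nk b) -!mul_polyC => E; apply: (mulfI NO0).
  by apply/eqP; rewrite -subr_eq0 -E; apply/eqP; ring.
have rE v : TP (line_param (k a *: O - a) (k b *: O - b))
    (line_param (k a *: O - a) (k b *: O - b)) (vP v) = (k v)%:P * TP (vP O) d d.
  have := Nk v; rewrite NO {1}/N (residual_line_param gE) triZ1 // triZ2 //.
  rewrite -mul_polyC; set Y := TP (line_param _ _) _ _; set q := TP (vP O) d d => E.
  have q3 : (3 * q) ^+ 2 != 0 by rewrite expf_neq0 ?mulf_neq0.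
  apply: (mulfI q3); transitivity (3 * q * (3 * q * Y)); first by ring.
  by rewrite E; ring.
have kE v := tri_line_param_coef (rE v).
apply: (@gauss_nonconstant _ c sc nc _ _ k (T O a a) (2 * T O a b) (T O b b)
  (@line_param_indep (k a) (k b))) => v; by have [] := kE v.
Qed.

End Residual.

(** The point p is the residual point of a tangent line at R with direction e. The
    polar form at R is nonzero as a function of p as soon as neither T R R' e nor
    T R e e vanishes; starting from e0, which satisfies the first condition, a
    suitable combination of e0 and R' satisfies both. *)
Lemma tangent_section_point R R' e0 : 2 != 0 :> L -> 3 != 0 :> L ->
  cub c R = 0 -> T R R R' = 0 -> T R R e0 = 0 -> T R R' e0 != 0 ->
  exists p, [/\ cub c p = 0, T R R p = 0 & T R R' p != 0].
Proof.
move=> two0 three0 R0 RR' Re0 m0.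
have [e [Re e1 e2]] : exists e, [/\ T R R e = 0, T R R' e != 0 & T R e e != 0].
  have [z|z] := eqVneq (T R e0 e0) 0; last by exists e0.
  have [w|w] := eqVneq (T R R' R') 0.
    exists (e0 + R'); rewrite !triE // Re0 RR' w z (triC23 sc R e0 R') addr0.
    by split=> //; rewrite ?addr0 // add0r -mulr2n -mulr_natr mulf_neq0.
  (* The conditions on e0 + k *: R' exclude three values of k, and this is
     another one. *)
  set k := T R R' e0 / T R R' R'.
  exists (e0 + k *: R'); rewrite !triE // Re0 RR' z (triC23 sc R e0 R').
  split; first by rewrite mulr0 addr0.
    by rewrite divfK // -mulr2n -mulr_natr mulf_neq0.
  rewrite divfK //.
  have -> : 0 + k * T R R' e0 + (k * T R R' e0 + k * T R R' e0) = 3 * (k * T R R' e0).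
    by ring.
  by rewrite !mulf_neq0 ?invr_eq0.
exists (cub c e *: R - (3 * T R e e) *: e); rewrite -scaleNr cub_pencil //.
rewrite R0 Re [T R R' _]triD3 // !triZ3 // triD3 // !triZ3 // Re.
rewrite [T R R R]R0 [T R R' R]triC23 // RR'.
split; [by ring|by ring|].
by rewrite mulr0 add0r mulf_neq0 ?oppr_eq0 ?mulf_neq0.
Qed.

End TangentCurve.

(** * Continuity of roots over a complete valued field *)

Definition complete_for (R : realType) (L : fieldType) (a : L -> R) :=
  forall u : nat -> L,
  (forall e : R, 0 < e -> exists N, forall m n, (N <= m)%N -> (N <= n)%N ->
     a (u m - u n) < e) ->
  exists l, forall e : R, 0 < e -> exists N, forall n, (N <= n)%N ->
    a (u n - l) < e.

Section ValuedField.
Context (R : realType) (L : fieldType) (a : L -> R).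
Hypothesis aP : absolute_value a.

Lemma abs0 : a 0 = 0. Proof. exact/(abs_eq0 aP). Qed.

Lemma abs_gt0 x : (0 < a x) = (x != 0).
Proof.
rewrite lt_def (abs_ge0 aP) andbT; congr (~~ _).
by apply/eqP/eqP => /(abs_eq0 aP).
Qed.

Lemma abs1 : a 1 = 1.
Proof.
have a1 : a 1 != 0 by rewrite gt_eqF // abs_gt0 oner_eq0.
by apply: (mulfI a1); rewrite -(absM aP) !mulr1.
Qed.

Lemma absN x : a (- x) = a x.
Proof.
have aN1 : a (-1) = 1.
  apply/eqP; rewrite -(@eqrXn2 _ 2) ?(abs_ge0 aP) // expr1n.
  by rewrite expr2 -(absM aP) mulrNN mulr1 abs1.
by rewrite -mulN1r (absM aP) aN1 mul1r.
Qed.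

Lemma absC x y : a (x - y) = a (y - x). Proof. by rewrite -absN opprB. Qed.

Lemma absB_le x y z : a (x - z) <= a (x - y) + a (y - z).
Proof. by apply: le_trans (absD aP _ _); rewrite addrA subrK. Qed.

Lemma absX x n : a (x ^+ n) = a x ^+ n.
Proof. by elim: n => [|n IH]; rewrite ?abs1 // !exprS (absM aP) IH. Qed.

Definition near_scalar (x : L) : set_system L :=
  [set A | exists2 e : R, 0 < e & forall y, a (y - x) < e -> A y].

Definition near_vector n (x : 'rV[L]_n) : set_system 'rV[L]_n :=
  [set A : set 'rV[L]_n | exists2 e : R, 0 < e &
     forall y : 'rV[L]_n, (forall i, a (y 0 i - x 0 i) < e) -> A y].

Global Instance near_scalar_filter x : Filter (near_scalar x).
Proof.
split=> [|P Q [e e0 He] [d d0 Hd]|P Q PQ [e e0 He]]; first by exists 1.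
  exists (Num.min e d); first by rewrite lt_min e0.
  by move=> y; rewrite lt_min => /andP[/He ? /Hd].
by exists e => // y /He/PQ.
Qed.

Global Instance near_vector_filter n (x : 'rV[L]_n) : Filter (near_vector x).
Proof.
split=> [|P Q [e e0 He] [d d0 Hd]|P Q PQ [e e0 He]]; first by exists 1.
  exists (Num.min e d); first by rewrite lt_min e0.
  by move=> y Hy; split; [apply: He|apply: Hd] => i;
    have := Hy i; rewrite lt_min => /andP[].
by exists e => // y /He/PQ.
Qed.

(** Convergence along an arbitrary filter, so that one notion serves for scalars,
    vectors and pairs of a parameter and a scalar. *)
Definition tends (I : Type) (B : set_system I) (f : I -> L) (l : L) :=
  forall e : R, 0 < e -> B [set i | a (f i - l) < e].

Lemma tends_id x : tends (near_scalar x) id x.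
Proof. by move=> e e0; exists e. Qed.

Lemma tends_coord n (x : 'rV[L]_n) j : tends (near_vector x) (fun y => y 0 j) (x 0 j).
Proof. by move=> e e0; exists e => // y /(_ j). Qed.

Section Tends.
Context (I : Type) (B : set_system I) {FB : Filter B}.
Implicit Types f g : I -> L.

Lemma tends_cst l : tends B (fun=> l) l.
Proof. by move=> e e0; apply: filterS filterT => i _ /=; rewrite subrr abs0. Qed.

Lemma tendsD f g l k : tends B f l -> tends B g k ->
  tends B (fun i => f i + g i) (l + k).
Proof.
move=> fl gk e e0; have e20 : 0 < e / 2 by rewrite divr_gt0.
apply: filterS (filterI (fl _ e20) (gk _ e20)) => i /= [fi gi].
rewrite opprD addrACA [e]splitr.
by apply: le_lt_trans (absD aP _ _) _; exact: ltrD.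
Qed.

Lemma tendsN f l : tends B f l -> tends B (fun i => - f i) (- l).
Proof. by move=> fl e e0; apply: filterS (fl _ e0) => i /=; rewrite -opprD absN. Qed.

Lemma tendsM f g l k : tends B f l -> tends B g k ->
  tends B (fun i => f i * g i) (l * k).
Proof.
move=> fl gk e e0; set M := a l + a k + 1.
have M0 : 0 < M by rewrite ltr_wpDl // addr_ge0 // (abs_ge0 aP).
have d0 : 0 < Num.min 1 (e / (M + M)) by rewrite lt_min ltr01 divr_gt0 // addr_gt0.
apply: filterS (filterI (fl _ d0) (gk _ d0)) => i /= [].
rewrite !lt_min => /andP[_ fi] /andP[g1 gi].
have -> : f i * g i - l * k = (f i - l) * g i + l * (g i - k) by ring.
apply: le_lt_trans (absD aP _ _) _; rewrite !(absM aP).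
have gM : a (g i) <= M.
  have -> : g i = (g i - k) + k by rewrite subrK.
  apply: le_trans (absD aP _ _) _; rewrite addrC /M lerD ?(ltW g1) //.
  by rewrite lerDr (abs_ge0 aP).
have lM : a l <= M by rewrite /M -addrA lerDl addr_ge0 // (abs_ge0 aP).
have -> : e = e / (M + M) * M + M * (e / (M + M)).
  by rewrite [M * _]mulrC -mulrDr divfK // gt_eqF // addr_gt0.
have eM : 0 < e / (M + M) by rewrite divr_gt0 // addr_gt0.
apply: ltr_leD.
  apply: (@le_lt_trans _ _ (a (f i - l) * M)); last by rewrite ltr_pM2r.
  by rewrite ler_wpM2l // (abs_ge0 aP).
by apply: ler_pM; rewrite ?(abs_ge0 aP) // ltW.
Qed.

Lemma tendsX f l n : tends B f l -> tends B (fun i => f i ^+ n) (l ^+ n).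
Proof.
move=> fl; elim: n => [|n IH]; first exact: tends_cst.
have -> : (fun i => f i ^+ n.+1) = (fun i => f i * f i ^+ n).
  by apply/funext => i; rewrite exprS.
by rewrite exprS; exact: tendsM.
Qed.

Lemma tends_sum (J : Type) (r : seq J) (P : pred J) (f : J -> I -> L) l :
  (forall j, P j -> tends B (f j) (l j)) ->
  tends B (fun i => \sum_(j <- r | P j) f j i) (\sum_(j <- r | P j) l j).
Proof.
move=> fl; elim: r => [|j r IH].
  have -> : (fun i => \sum_(j <- [::] | P j) f j i) = (fun=> 0).
    by apply/funext => i; rewrite big_nil.
  by rewrite big_nil; exact: tends_cst.
have -> : (fun i => \sum_(j <- j :: r | P j) f j i) =
    (fun i => if P j then f j i + \sum_(j <- r | P j) f j i
              else \sum_(j <- r | P j) f j i).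
  by apply/funext => i; rewrite big_cons.
by rewrite big_cons; case: ifP => // Pj; apply: tendsD => //; exact: fl.
Qed.

Lemma tends_neq0 f l : tends B f l -> l != 0 -> B [set i | f i != 0].
Proof.
move=> fl l0; have al : 0 < a l by rewrite abs_gt0.
apply: filterS (fl _ al) => i /=; apply: contraTneq => ->.
by rewrite sub0r absN ltxx.
Qed.

Lemma tends_horner f l (p : {poly L}) : tends B f l ->
  tends B (fun i => p.[f i]) p.[l].
Proof.
move=> fl; have -> : (fun i => p.[f i]) = (fun i => \sum_(j < size p) p`_j * f i ^+ j).
  by apply/funext => i; rewrite horner_coef.
by rewrite horner_coef; apply: tends_sum => j _; apply: tendsM (tendsX _ fl); exact: tends_cst.
Qed.

End Tends.

Lemma tends_fst (I J : Type) (B : set_system I) (C : set_system J) {FB : Filter B}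
  {FC : Filter C} f l : tends B f l -> tends (filter_prod B C) (f \o fst) l.
Proof.
move=> fl e e0; exists ([set i | a (f i - l) < e], setT) => /=.
  by split=> //; [exact: fl|exact: filterT].
by case=> i j [].
Qed.

Lemma tends_snd (I J : Type) (B : set_system I) (C : set_system J) {FB : Filter B}
  {FC : Filter C} f l : tends C f l -> tends (filter_prod B C) (f \o snd) l.
Proof.
move=> fl e e0; exists (setT, [set i | a (f i - l) < e]) => /=.
  by split=> //; [exact: filterT|exact: fl].
by case=> i j [].
Qed.

Lemma expr_small (x e : R) : 0 <= x -> x < 1 -> 0 < e ->
  exists N, forall n, (N <= n)%N -> x ^+ n < e.
Proof.
move=> x0 x1 e0; have [->|xN0] := eqVneq x 0.
  by exists 1%N => -[|n] // _; rewrite expr0n.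
have xp : 0 < x by rewrite lt_def xN0.
set h := x^-1 - 1; have h0 : 0 < h by rewrite subr_gt0 invf_gt1.
have bern n : 1 + n%:R * h <= x^-1 ^+ n.
  elim: n => [|n IH]; first by rewrite mul0r addr0.
  rewrite exprS; apply: le_trans (ler_wpM2l _ IH); last by rewrite invr_ge0.
  have -> : x^-1 = 1 + h by rewrite /h addrC subrK.
  have -> : (1 + h) * (1 + n%:R * h) = 1 + n.+1%:R * h + n%:R * (h * h).
    by rewrite -natr1; ring.
  by rewrite lerDl mulr_ge0 // mulr_ge0 // ltW.
exists (Num.bound (e^-1 / h)) => n Nn.
have : e^-1 / h < n%:R.
  apply: (@lt_le_trans _ _ (Num.bound (e^-1 / h))%:R).
    by rewrite archi_boundP // divr_ge0 // ?invr_ge0 ltW.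
  by rewrite ler_nat.
rewrite ltr_pdivrMr // => en.
have : e^-1 < x^-1 ^+ n by apply: lt_le_trans (bern n); rewrite ltr_wpDl.
by rewrite exprVn ltf_pV2 // posrE exprn_gt0.
Qed.

Hypothesis a_complete : complete_for a.

(** The iteration [z - q z / b] contracts the ball of radius r around z0 by a
    factor 1/2, and the bound on q z0 keeps it inside this ball. *)
Lemma newton (q : L -> L) (b z0 : L) (r : R) : b != 0 -> 0 < r ->
  (forall z y, a (z - z0) <= r -> a (y - z0) <= r ->
     a (q z - q y - b * (z - y)) <= a b / 2 * a (z - y)) ->
  a (q z0) <= a b * (r / 2) ->
  exists2 z, a (z - z0) <= r & q z = 0.
Proof.
move=> b0 r0 lip q0; have ab : 0 < a b by rewrite abs_gt0.
pose u := fix u n := if n is n'.+1 then u n' - q (u n') / b else z0.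
have qu n : q (u n) = b * (u n - u n.+1) by rewrite /=; field.
have step n : a (u n - z0) <= r - r * 2^-1 ^+ n /\ a (u n.+1 - u n) <= r / 2 * 2^-1 ^+ n.
  elim: n => [|n [IH1 IH2]].
    rewrite /= subrr abs0 expr0 !mulr1 subrr; split=> //.
    have -> : z0 - q z0 / b - z0 = - (b^-1 * q z0) by ring.
    rewrite absN -(ler_pM2l ab) -(absM aP) mulrA divff // mul1r.
    exact: q0.
  have h : a (u n.+1 - z0) <= r - r * 2^-1 ^+ n.+1.
    apply: le_trans (absB_le _ (u n) _) _.
    have -> : r - r * 2^-1 ^+ n.+1 = r / 2 * 2^-1 ^+ n + (r - r * 2^-1 ^+ n).
      by rewrite exprS; field.
    exact: lerD.
  split=> //.
  have rn m : a (u m - z0) <= r - r * 2^-1 ^+ m -> a (u m - z0) <= r.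
    by move=> h'; apply: le_trans h' _; rewrite gerBl mulr_ge0 ?exprn_ge0 ?invr_ge0 // ltW.
  have := lip _ _ (rn _ h) (rn _ IH1).
  have -> : q (u n.+1) - q (u n) - b * (u n.+1 - u n) = b * (u n.+1 - u n.+2).
    by rewrite qu (qu n); ring.
  rewrite (absM aP) -mulrA ler_pM2l // => h'; rewrite [a _]absC; apply: le_trans h' _.
  by rewrite exprS mulrCA ler_wpM2l ?invr_ge0.
have cauchy n k : a (u (n + k)%N - u n) <= r * 2^-1 ^+ n - r * 2^-1 ^+ (n + k).
  elim: k => [|k IH]; first by rewrite addn0 !subrr abs0.
  apply: le_trans (absB_le _ (u (n + k)%N) _) _.
  have -> : r * 2^-1 ^+ n - r * 2^-1 ^+ (n + k.+1) =
    r / 2 * 2^-1 ^+ (n + k) + (r * 2^-1 ^+ n - r * 2^-1 ^+ (n + k)).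
    by rewrite addnS exprS; field.
  by apply: lerD IH; rewrite addnS; have [] := step (n + k)%N.
have half1 : (2^-1 : R) < 1 by rewrite invf_lt1 // ltr1n.
have tail e : 0 < e -> exists N, forall n k, (N <= n)%N -> a (u (n + k)%N - u n) < e.
  move=> e0; have er : 0 < e / r by rewrite divr_gt0.
  have [|N HN] := expr_small _ half1 er; first by rewrite invr_ge0.
  exists N => n k Nn; apply: le_lt_trans (cauchy n k) _.
  apply: (@le_lt_trans _ _ (r * 2^-1 ^+ n)).
    by rewrite gerBl mulr_ge0 ?exprn_ge0 ?invr_ge0 // ltW.
  by rewrite mulrC -ltr_pdivlMr // HN.
have [z zl] : exists l, forall e : R, 0 < e -> exists N, forall n, (N <= n)%N -> a (u n - l) < e.
  apply: a_complete => e e0; have [N HN] := tail _ (divr_gt0 e0 (ltr0n _ 2)).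
  exists N => m n Nm Nn; have [mn|/ltW nm] := leP m n.
    by rewrite absC -(subnKC mn); apply: lt_trans (HN _ _ Nm) _; rewrite gtr_pMr ?invf_lt1 // ltr1n.
  by rewrite -(subnKC nm); apply: lt_trans (HN _ _ Nn) _; rewrite gtr_pMr ?invf_lt1 // ltr1n.
have un n : a (u n - z0) <= r.
  by have [h' _] := step n; apply: le_trans h' _; rewrite gerBl mulr_ge0 ?exprn_ge0 ?invr_ge0 // ltW.
have zr : a (z - z0) <= r.
  apply/ler_addgt0Pr => e e0; have [N HN] := zl e e0.
  apply: le_trans (absB_le _ (u N) _) _; rewrite addrC lerD ?un //.
  by rewrite absC ltW // HN.
exists z => //; apply/(abs_eq0 aP)/eqP; rewrite eq_le (abs_ge0 aP) andbT.
apply/ler_addgt0Pr => e e0; rewrite add0r.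
have d0 : 0 < e / (4 * a b) by rewrite divr_gt0 // mulr_gt0.
have [N HN] := zl _ d0.
have -> : q z = - (q (u N) - q z - b * (u N - z)) + b * (z - u N.+1) by rewrite qu; ring.
apply: le_trans (absD aP _ _) _; rewrite absN.
(* The two error terms are at most e / 8 and e / 4. *)
have -> : e = a b / 2 * (e / (4 * a b)) + a b * (e / (4 * a b)) + 5 / 8 * e.
  by field; rewrite gt_eqF.
rewrite -[X in X <= _]addr0; apply: lerD; last by rewrite mulr_ge0 ?divr_ge0 // ltW.
apply: lerD.
  by apply: le_trans (lip _ _ (un N) zr) _; rewrite ler_wpM2l ?divr_ge0 ?(ltW ab) // ltW // HN.
by rewrite (absM aP) ler_wpM2l ?(ltW ab) // absC ltW // HN.
Qed.

Definition diff_quotient (m : nat) (p : {poly L}) (z y : L) : L :=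
  \sum_(k < m) p`_k * \sum_(j < k) z ^+ (k.-1 - j) * y ^+ j.

Lemma diff_quotientE m (p : {poly L}) (z y : L) : (size p <= m)%N ->
  p.[z] - p.[y] = (z - y) * diff_quotient m p z y.
Proof.
move=> sp; rewrite !(horner_coef_wide _ sp) -sumrB mulr_sumr.
apply: eq_bigr => k _; rewrite -mulrBr subrXX; ring.
Qed.

Lemma diff_quotient_diag m (p : {poly L}) (z : L) : (size p <= m)%N ->
  diff_quotient m p z z = p^`().[z].
Proof.
move=> sp; case: m sp => [|m] sp.
  move: sp; rewrite leqn0 size_poly_eq0 => /eqP ->.
  by rewrite deriv0 horner0 /diff_quotient big_ord0.
have sd : (size p^`() <= m)%N.
  apply/leq_sizeP => i mi; rewrite coef_deriv nth_default ?mul0rn //.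
  exact: leq_trans sp _.
rewrite (horner_coef_wide _ sd) /diff_quotient big_ord_recl big_ord0 mulr0 add0r.
apply: eq_bigr => k _; rewrite coef_deriv lift0 /=.
rewrite mulrnAl -mulrnAr; congr (_ * _).
rewrite (eq_bigr (fun=> z ^+ k)) ?sumr_const ?card_ord // => j _.
by rewrite -exprD subnK // -ltnS.
Qed.

(** The difference quotient of p i is a polynomial in z and y whose coefficients
    tend to those for p0, so that near z0 it is close to the derivative of p0 at z0,
    and [newton] applies. The root is given inside an arbitrary neighbourhood of
    the pair formed by the limit of the parameter and z0. *)
Lemma simple_root_continuous (I : Type) (B : set_system I) {FB : Filter B}
    (m : nat) (p : I -> {poly L}) (p0 : {poly L}) (z0 : L) :
  (size p0 <= m)%N -> (forall i, (size (p i) <= m)%N) ->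
  (forall k, tends B (fun i => (p i)`_k) p0`_k) ->
  root p0 z0 -> p0^`().[z0] != 0 ->
  forall A : set (I * L), filter_prod B (near_scalar z0) A ->
    B [set i | exists2 z, A (i, z) & root (p i) z].
Proof.
move=> sp0 sp pk /eqP p00 b0 A; set b := p0^`().[z0] in b0.
have ab : 0 < a b by rewrite abs_gt0.
have ab2 : 0 < a b / 2 by rewrite divr_gt0.
pose BNN := filter_prod B (filter_prod (near_scalar z0) (near_scalar z0)).
have dq : tends BNN (fun t => diff_quotient m (p t.1) t.2.1 t.2.2) b.
  rewrite /b -(diff_quotient_diag z0 sp0).
  apply: tends_sum => k _; apply: tendsM; first exact: (tends_fst (pk k)).
  apply: tends_sum => j _; apply: tendsM; apply: tendsX.
    exact: (tends_snd (tends_fst (@tends_id z0))).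
  exact: (tends_snd (tends_snd (@tends_id z0))).
have [[B1 N1] /= [BB1 [[N2 N3] /= [[e1 e10 He1] [e3 e30 He3]] sub3]] sub1] := dq _ ab2.
move=> [[B2 N4] /= [BB2 [e2 e20 He2]] sub2].
set r := Num.min (Num.min e1 e3) e2 / 2.
have m0 : 0 < Num.min (Num.min e1 e3) e2 by rewrite !lt_min e10 e30.
have r0 : 0 < r by rewrite divr_gt0.
have /and3P[r1 r3 r2] : [&& r < e1, r < e3 & r < e2].
  by rewrite andbA -!lt_min gtr_pMr // invf_lt1 // ltr1n.
have p_z0 : tends B (fun i => (p i).[z0]) 0.
  rewrite -p00 (horner_coef_wide _ sp0).
  have -> : (fun i => (p i).[z0]) = (fun i => \sum_(k < m) (p i)`_k * z0 ^+ k).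
    by apply/funext => i; rewrite (horner_coef_wide _ (sp i)).
  by apply: tends_sum => k _; apply: tendsM => //; exact: tends_cst.
have br0 : 0 < a b * (r / 2) by rewrite mulr_gt0 // divr_gt0.
apply: filterS (filterI (filterI BB1 BB2) (p_z0 _ br0)) => i /= [[B1i B2i]].
rewrite subr0 => pz.
have [||z zr pz0] := @newton (horner (p i)) b z0 r b0 r0.
- move=> z y zr yr; rewrite (diff_quotientE _ _ (sp i)) mulrC -mulrBl (absM aP).
  rewrite ler_wpM2r ?(abs_ge0 aP) // ltW //.
  apply: (sub1 (i, (z, y))); split=> //=.
  apply: (sub3 (z, y)); split=> /=; [apply: He1|apply: He3].
    exact: le_lt_trans zr _.
  exact: le_lt_trans yr _.
- exact: ltW.
exists z; last exact/eqP.
by apply: (sub2 (i, z)); split=> //=; apply: He2; exact: le_lt_trans zr _.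
Qed.

End ValuedField.

(** * The surface near a point *)

Section LocalGeometry.
Context (R : realType) (L : fieldType) (a : L -> R).
Hypothesis aP : absolute_value a.
Hypothesis a_complete : complete_for a.
Hypothesis a_nontrivial : exists2 t, t != 0 & a t < 1.

(** Powers of a scalar t with [a t < 1] provide as many small scalars as needed. *)
Lemma small_nonroot (p : {poly L}) (e : R) : p != 0 -> 0 < e ->
  exists2 x, a x < e & p.[x] != 0.
Proof.
move=> p0 e0; have [t t0 t1] := a_nontrivial.
have at0 : 0 < a t by rewrite abs_gt0.
have [N HN] := expr_small (ltW at0) t1 e0.
apply: contrapT => H.
have /(max_poly_roots p0) : all (root p) [seq t ^+ n | n <- iota N (size p)].
  apply/allP => y /mapP[n + ->]; rewrite mem_iota => /andP[Nn _].
  by apply/negPn/negP => r; apply: H; exists (t ^+ n); rewrite ?(absX aP) ?HN.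
rewrite map_inj_uniq ?iota_uniq ?size_map ?size_iota ?ltnn; first by move/(_ isT).
by move=> m n /(congr1 a); rewrite !(absX aP); apply: ieexprIn => //; rewrite lt_eqF.
Qed.

Definition tendsv (I : Type) (B : set_system I) (f : I -> 'rV[L]_4) (l : 'rV[L]_4) :=
  forall j, tends a B (fun i => f i 0 j) (l 0 j).

Section TendsV.
Context (I : Type) (B : set_system I) {FB : Filter B}.

Lemma tendsv_cst l : tendsv B (fun=> l) l.
Proof. by move=> j; exact: (tends_cst aP). Qed.

Lemma tendsvD (f g : I -> 'rV[L]_4) l k : tendsv B f l -> tendsv B g k ->
  tendsv B (fun i => f i + g i) (l + k).
Proof.
move=> fl gk j; rewrite mxE; under [X in tends _ _ X]eq_fun do rewrite mxE.
by apply: (tendsD aP).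
Qed.

Lemma tendsvZ (h : I -> L) (f : I -> 'rV[L]_4) l k : tends a B h l ->
  tendsv B f k -> tendsv B (fun i => h i *: f i) (l *: k).
Proof.
move=> fl gk j; rewrite mxE; under [X in tends _ _ X]eq_fun do rewrite mxE.
by apply: (tendsM aP).
Qed.

Lemma tendsv_ev (RP : 'rV[{poly L}]_4) h l : tends a B h l ->
  tendsv B (fun i => map_mx (horner_eval (h i)) RP) (map_mx (horner_eval l) RP).
Proof.
move=> hl j; rewrite mxE; under [X in tends _ _ X]eq_fun do rewrite mxE.
exact: (tends_horner aP).
Qed.

Lemma tends_tri (c : tensor L) (f g h : I -> 'rV[L]_4) x y z :
  tendsv B f x -> tendsv B g y -> tendsv B h z ->
  tends a B (fun i => tri c (f i) (g i) (h i)) (tri c x y z).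
Proof.
move=> fx gy hz; rewrite /tri; apply: (tends_sum aP) => i _; apply: (tends_sum aP) => j _.
apply: (tends_sum aP) => k _; apply: (tendsM aP); first exact: (tends_cst aP).
by apply: (tendsM aP); [apply: (tendsM aP); [exact: fx|exact: gy]|exact: hz].
Qed.

End TendsV.

Context (c : tensor L).
Hypotheses (sc : symmetric3 c) (nc : nonsingular c) (L0 : [pchar L] =i pred0).
Local Notation T := (tri c).

Local Ltac tends_tac := repeat first
  [ assumption | exact: tends_id | exact: (tends_cst aP) | exact: tendsv_cst
  | apply: (tendsD aP) | apply: (tendsM aP) | apply: (tendsN aP) | apply: (tendsX aP)
  | apply: tends_tri | apply: tendsvD | apply: tendsvZ ].

(** This case of the implicit function theorem follows from the continuity of
    roots: at [x = 0] the polynomial in y has the simple root 0, because n is not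
    in the tangent plane. *)
Lemma surface_graph O v n e : cub c O = 0 -> T O O n != 0 -> 0 < e ->
  exists2 d, 0 < d & forall x, a x < d ->
    exists2 y, a y < e & cub c (O + x *: v + y *: n) = 0.
Proof.
move=> O0 On e0.
pose p x := Poly [:: cub c (O + x *: v);
  3 * T (O + x *: v) (O + x *: v) n; 3 * T (O + x *: v) n n; cub c n].
have pE x y : (p x).[y] = cub c (O + x *: v + y *: n).
  rewrite horner_Poly /= -[O + x *: v]scale1r cub_pencil // scale1r; ring.
have p00 : root (p 0) 0 by rewrite /root pE !scale0r !addr0 O0.
have p01 : (p 0)^`().[0] != 0.
  rewrite horner_coef0 coef_deriv coef_Poly /= scale0r addr0 mulr1n.
  by rewrite mulf_neq0 // (natf_neq0_char0 L0 2).
have near_e : filter_prod (near_scalar a 0) (near_scalar a 0) [set t | a t.2 < e].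
  exists (setT, [set y | a y < e]) => /=; last by case=> x y [].
  by split; [exact: filterT|exists e => // y; rewrite subr0].
have tends_p k : tends a (near_scalar a 0) (fun x => (p x)`_k) (p 0)`_k.
  rewrite coef_Poly; under [X in tends _ _ X]eq_fun do rewrite coef_Poly.
  by case: k => [|[|[|[|k]]]] /=; rewrite /cub ?nth_nil; tends_tac.
have sp x : (size (p x) <= 4)%N by exact: size_Poly.
have [d d0 Hd] := simple_root_continuous aP a_complete (sp 0) sp tends_p p00 p01 near_e.
exists d => // x xd; have [|y ye /eqP yp] := Hd x; first by rewrite subr0.
by exists y => //; rewrite -pE.
Qed.

(** The conclusion says that the section by the tangent plane at O' is not a cone
    with vertex O'. When O itself does not do, let w be in its tangent plane and
    off the surface. The points O + x w + y n of the surface near O then have y of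
    order [x ^+ 3], and [y = x ^+ 3 * z] turns the equation into one with a simple
    root z0 at [x = 0]. For such a point the quantity to be shown nonzero is x times
    a polynomial E in x and z, with [E 0 z0 != 0]. *)
Lemma exists_nonconical_section O : O != 0 -> cub c O = 0 ->
  exists O' b, [/\ cub c O' = 0, T O' O' b = 0 & T O' b b != 0].
Proof.
move=> ON0 O0; have [[b [Ob Obb]]|flat] :=
    pselect (exists b, T O O b = 0 /\ T O b b != 0); first by exists O, b.
have {}flat b : T O O b = 0 -> T O b b = 0.
  by move=> Ob; apply/eqP/negPn/negP => Obb; apply: flat; exists b.
have [w [Ow w0]] := tangent_plane_off sc nc L0 ON0.
have [n On] := gauss_neq0 nc ON0.
have Oww := flat w Ow.
set g := cub c w in w0; set t := T O O n in On.
have three0 : (3 : L) != 0 := natf_neq0_char0 L0 2.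
pose p x := Poly [:: g;
  3 * t + 6 * x * T O w n + 3 * x ^+ 2 * T w w n;
  3 * x ^+ 3 * T O n n + 3 * x ^+ 4 * T w n n; x ^+ 6 * cub c n].
pose pt x z := O + x *: w + (x ^+ 3 * z) *: n.
have pE x z : cub c (pt x z) = x ^+ 3 * (p x).[z].
  rewrite /pt -[O + _]scale1r cub_pencil // /p horner_Poly /=.
  rewrite -[O]scale1r cub_pencil // tri_pencil2 // O0 Ow Oww !triE //.
  rewrite -/g -/t; ring.
pose z0 := - g / (3 * t).
have z0P : 3 * t * z0 = - g by rewrite /z0 mulrC divfK // mulf_neq0.
have p00 : root (p 0) z0.
  rewrite /root horner_Poly /= !expr0n /= !(mulr0, mul0r, addr0, add0r).
  by rewrite z0P addNr.
have p01 : (p 0)^`().[z0] != 0.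
  have -> : p 0 = g%:P + (3 * t)%:P * 'X.
    apply/polyP => k; rewrite coef_Poly coefD coefC coefCM coefX.
    by case: k => [|[|[|[|k]]]] /=;
      rewrite ?expr0n /= ?(mulr0, mul0r, addr0, add0r, mulr1) ?nth_nil.
  by rewrite !derivE !hornerE mulf_neq0.
have sp x : (size (p x) <= 4)%N by exact: size_Poly.
have tends_p k : tends a (near_scalar a 0) (fun x => (p x)`_k) (p 0)`_k.
  rewrite coef_Poly; under [X in tends _ _ X]eq_fun do rewrite coef_Poly.
  by case: k => [|[|[|[|k]]]] /=; rewrite ?nth_nil; tends_tac.
(* These are T (pt x z) (pt x z) w, divided by x ^+ 2, and
   T (pt x z) (pt x z) n: the tangent vector used below is N w - (x ^+ 2 M) n. *)
pose M x z := g + 2 * x * z * T O w n + 2 * x ^+ 2 * z * T w w n +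
  x ^+ 4 * z ^+ 2 * T w n n.
pose N x z := T (pt x z) (pt x z) n.
pose E x z := N x z ^+ 2 * (g + x ^+ 2 * z * T w w n) -
  2 * x * N x z * M x z * T (pt x z) w n + x ^+ 3 * M x z ^+ 2 * T (pt x z) n n.
pose B2 := filter_prod (near_scalar a 0) (near_scalar a z0).
have x_to : tends a B2 (fun s => s.1) 0 by exact: (tends_fst (@tends_id _ _ _ 0)).
have z_to : tends a B2 (fun s => s.2) z0 by exact: (tends_snd (@tends_id _ _ _ z0)).
have E_to : tends a B2 (fun s => E s.1 s.2) (E 0 z0).
  rewrite /E /N /M /pt; tends_tac; solve [exact: x_to | exact: z_to].
have E0 : E 0 z0 != 0.
  rewrite /E /N /pt !expr0n /= !(mulr0, mul0r, scale0r, addr0, subr0).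
  by rewrite mulf_neq0 // expf_neq0.
have near_E : B2 [set s | E s.1 s.2 != 0] by exact: (tends_neq0 aP E_to E0).
have [d d0 Hd] := simple_root_continuous aP a_complete (sp 0) sp tends_p p00 p01 near_E.
have X0 : 'X != 0 :> {poly L} by rewrite polyX_eq0.
have [x xd] := small_nonroot X0 d0; rewrite hornerX => x0.
have [|z Exz /eqP pz] := Hd x; first by rewrite subr0.
have Pw : T (pt x z) (pt x z) w = x ^+ 2 * M x z.
  rewrite /pt /M -[O + _]scale1r tri_pencil2 // -[O]scale1r tri_pencil2 //.
  rewrite !triE // Ow Oww (triC23 sc O n w) (triC23 sc w n w) (triC13 sc n n w).
  rewrite -/g -[T w w w]/g; ring.
have Pww : T (pt x z) w w = x * (g + x ^+ 2 * z * T w w n).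
  by rewrite /pt !triE // Oww (triC13 sc n w w) -[T w w w]/g; ring.
exists (pt x z), (N x z *: w - T (pt x z) (pt x z) w *: n); split.
- by rewrite pE pz mulr0.
- by rewrite triD3 // triN3 // !triZ3 // -/(N x z) mulrC subrr.
have sq (P u v : 'rV[L]_4) k m : T P (k *: u - m *: v) (k *: u - m *: v) =
    k ^+ 2 * T P u u - 2 * k * m * T P u v + m ^+ 2 * T P v v.
  by rewrite !triE // (triC23 sc P v u); ring.
have -> : T (pt x z) (N x z *: w - T (pt x z) (pt x z) w *: n)
    (N x z *: w - T (pt x z) (pt x z) w *: n) = x * E x z.
  by rewrite sq Pw Pww /E; ring.
by rewrite mulf_neq0.
Qed.

(** For a curve [Rv] on the surface, [T (Rv t) (Rv t) y = 0] means that y is on the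
    tangent plane at [Rv t]. As a polynomial in t this has at [y = p] the simple
    root t0, which therefore persists for y near p. *)
Lemma polar_root_near (RP : 'rV[{poly L}]_4) (q : {poly L}) (t0 : L)
    (p : 'rV[L]_4) (Rv := fun t => map_mx (horner_eval t) RP)
    (Rv' := fun t => map_mx (horner_eval t) (map_mx deriv RP)) :
  q.[t0] != 0 -> T (Rv t0) (Rv t0) p = 0 -> T (Rv t0) (Rv' t0) p != 0 ->
  near_vector a p [set y | exists t,
    [/\ q.[t] != 0, T (Rv t) (Rv t) y = 0 & T (Rv t) (Rv' t) y != 0]].
Proof.
move=> q0 Rp Rp'; pose TP := tri (tmap polyC c).
pose phi y := TP RP RP (map_mx polyC y).
have phiE y t : (phi y).[t] = T (Rv t) (Rv t) y.
  by rewrite /phi /TP horner_tri ev_polyC.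
have scP : symmetric3 (tmap polyC c) by exact: symmetric3_map.
have dphiE y t : (phi y)^`().[t] = 2 * T (Rv t) (Rv' t) y.
  rewrite /phi /TP deriv_tri hornerD hornerD !horner_tri deriv_polyC ev_polyC.
  by rewrite (triC12 sc (Rv' t)) map_mx0 tri03 //; ring.
pose e k : 'rV[L]_4 := delta_mx 0 k.
have phi_sum y : phi y = \sum_k y 0 k *: phi (e k).
  rewrite /phi /TP tri_row3 //; apply: eq_bigr => k _.
  by rewrite mxE mul_polyC map_delta_mx.
pose m := \max_k size (phi (e k)).
have sphi y : (size (phi y) <= m)%N.
  rewrite phi_sum; apply: leq_trans (size_sum _ _ _) _; apply/bigmax_leqP => k _.
  by apply: leq_trans (size_scale_leq _ _) _; exact: (leq_bigmax k).
have tends_phi k : tends a (near_vector a p) (fun y => (phi y)`_k) (phi p)`_k.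
  have E y : (phi y)`_k = \sum_j y 0 j * (phi (e j))`_k.
    by rewrite phi_sum coef_sum; apply: eq_bigr => j _; rewrite coefZ.
  rewrite E; under [X in tends _ _ X]eq_fun do rewrite E.
  apply: (tends_sum aP) => j _; apply: (tendsM aP); last exact: (tends_cst aP).
  exact: tends_coord.
have r0 : root (phi p) t0 by rewrite /root phiE Rp.
have r1 : (phi p)^`().[t0] != 0.
  by rewrite dphiE mulf_neq0 // (natf_neq0_char0 L0 1).
pose B2 := filter_prod (near_vector a p) (near_scalar a t0).
have t_to : tends a B2 (fun s => s.2) t0 by exact: (tends_snd (@tends_id _ _ _ t0)).
have near1 : B2 [set s | q.[s.2] != 0].
  by apply: (tends_neq0 aP) q0; exact: tends_horner.
have near2 : B2 [set s | T (Rv s.2) (Rv' s.2) s.1 != 0].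
  apply: (tends_neq0 aP) Rp'; apply: tends_tri; try exact: tendsv_ev.
  by move=> j; exact: (tends_fst (@tends_coord _ _ a _ p j)).
apply: filterS (simple_root_continuous aP a_complete (sphi p) sphi tends_phi r0 r1
  (filterI near1 near2)) => y [t [/= q1 q2] /eqP r].
by exists t; rewrite -phiE.
Qed.

End LocalGeometry.

(** * Homogeneous coordinates and collinear triples *)

Definition rep (L : fieldType) (F : cubic_form L) (P : surface_point F)
    (x : 'rV[L]_4) := x != 0 /\ x \in point_space P.

Section Points.
Context (L : fieldType) (F : cubic_form L) (c : tensor L).
Hypotheses (sc : symmetric3 c) (Fc : (F : {mpoly L[4]}) = tensor_form c).
Local Notation T := (tri c).
Implicit Types (P Q R : surface_point F) (x y u w : 'rV[L]_4) (l : proj_line L).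

Lemma proj_point_span (X : proj_point L) x :
  x != 0 -> x \in val X -> val X = <[x]>%VS.
Proof.
move=> x0 xX; apply/esym/eqP; rewrite eqEdim dim_vline x0 (eqP (valP X)) andbT.
by rewrite -memvE.
Qed.

Lemma vpick_proj_point (X : proj_point L) : vpick (val X) != 0.
Proof. by rewrite vpick0 -dimv_eq0 (eqP (valP X)). Qed.

Lemma rep_span P x : rep P x -> point_space P = <[x]>%VS.
Proof. by case=> x0; exact: proj_point_span. Qed.

Lemma rep_vpick P : rep P (vpick (point_space P)).
Proof. by split; [exact: vpick_proj_point|exact: memv_pick]. Qed.

Lemma rep_scale P x y : rep P x -> rep P y -> exists2 k, k != 0 & y = k *: x.
Proof.
move=> Px [y0]; rewrite (rep_span Px) => /vlineP[k yk]; exists k => //.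
by apply: contraNneq y0 => k0; rewrite yk k0 scale0r.
Qed.

Lemma rep_inj P Q x : rep P x -> rep Q x -> P = Q.
Proof.
by move=> Px Qx; do 2! apply/val_inj; rewrite -[LHS]/(point_space P) (rep_span Px) -(rep_span Qx).
Qed.

Lemma repZ P x k : k != 0 -> rep P x -> rep P (k *: x).
Proof. by move=> k0 [x0 xP]; split; [rewrite scaler_eq0 negb_or k0|exact: memvZ]. Qed.

Lemma rep_cub P x : rep P x -> cub c x = 0.
Proof.
move=> Px; have [k k0 ->] := rep_scale (rep_vpick P) Px.
have /eqP := valP P; rewrite Fc meval_tensor_form cubZ // => ->.
by rewrite mulr0.
Qed.

Lemma point_of_rep x : x != 0 -> cub c x = 0 -> exists P, rep P x.
Proof.
move=> x0 Fx; have d1 : \dim <[x]> == 1%N by rewrite dim_vline x0.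
pose X : proj_point L := exist _ <[x]>%VS d1.
have FX : on_surface F X.
  rewrite /on_surface Fc meval_tensor_form /=.
  by have /vlineP[k ->] := memv_pick <[x]>%VS; rewrite cubZ // Fx mulr0.
by exists (exist _ X FX); split=> //; exact: memv_line.
Qed.

Lemma rep_indep P Q x y : rep P x -> rep Q y -> P != Q -> indep x y.
Proof.
move=> Px Qy PQ; apply: (indepPn Px.1) => s; apply: contraNneq PQ => ys.
apply/eqP; apply: (rep_inj (x := y)) => //; rewrite ys; apply: repZ => //.
by apply: contraNneq Qy.1 => s0; rewrite ys s0 scale0r.
Qed.

Lemma line_basis l u w z : indep u w -> u \in val l -> w \in val l ->
  z \in val l -> exists s t, z = s *: u + t *: w.
Proof.
move=> iuw ul wl; have -> : val l = (<[u]> + <[w]>)%VS.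
  apply/esym/eqP; rewrite eqEdim subv_add -!memvE ul wl /= (eqP (valP l)).
  rewrite dimv_disjoint_sum ?dim_vline ?(indep_neq0l iuw) ?(indep_neq0r iuw) //.
  apply/eqP; rewrite -subv0; apply/subvP => v.
  rewrite memv_cap memv0 => /andP[/vlineP[s ->] /vlineP[t E]].
  have [|-> _] := iuw s (- t); last by rewrite scale0r.
  by rewrite E scaleNr subrr.
case/memv_addP => _ /vlineP[s ->] [_ /vlineP[t ->] ->]; by exists s, t.
Qed.

Lemma line_complement l (X : proj_point L) : (val X <= val l)%VS ->
  [/\ vpick (val X) \in val l, vpick (val l :\: val X)%VS \in val l &
      indep (vpick (val X)) (vpick (val l :\: val X)%VS)].
Proof.
move=> Xl; split; first by rewrite (subvP Xl) ?memv_pick.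
  by rewrite (subvP (diffvSl _ (val X))) ?memv_pick.
have y0 : vpick (val l :\: val X)%VS != 0.
  rewrite vpick0 diffv_eq0; apply/negP => /dimvS.
  by rewrite (eqP (valP l)) (eqP (valP X)).
apply: (indepPn (vpick_proj_point X)) => s; apply: contraNneq y0 => ys.
rewrite -memv0 -(capv_diff (val l) (val X)) memv_cap memv_pick /= ys.
by rewrite memvZ ?memv_pick.
Qed.

Lemma line_through u w : indep u w ->
  exists l : proj_line L, u \in val l /\ w \in val l.
Proof.
move=> iuw; have d2 : \dim (<[u]> + <[w]>)%VS == 2%N.
  rewrite dimv_disjoint_sum ?dim_vline ?(indep_neq0l iuw) ?(indep_neq0r iuw) //.
  apply/eqP; rewrite -subv0; apply/subvP => v.
  rewrite memv_cap memv0 => /andP[/vlineP[s ->] /vlineP[t E]].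
  have [|-> _] := iuw s (- t); last by rewrite scale0r.
  by rewrite E scaleNr subrr.
exists (exist _ (<[u]> + <[w]>)%VS d2) => /=; split.
  by rewrite (subvP (addvSl _ _)) ?memv_line.
by rewrite (subvP (addvSr _ _)) ?memv_line.
Qed.

Lemma alongE u w : along F u w =
  Poly [:: cub c u; 3 * T u u w; 3 * T u w w; cub c w].
Proof.
have -> : along F u w = cub (tmap polyC c) (1 *: map_mx polyC u + 'X *: map_mx polyC w).
  rewrite /along Fc /tensor_form scale1r raddf_sum; apply: eq_bigr => i _.
  rewrite raddf_sum; apply: eq_bigr => j _; rewrite raddf_sum; apply: eq_bigr => k _.
  by rewrite /= mmapZ !rmorphM /= !mmapX !mmap1U !mxE /tmap -!mul_polyC ![_ * 'X]mulrC.
rewrite cub_pencil; last exact: symmetric3_map.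
rewrite /cub !tri_polyC /= !cons_poly_def !polyCM.
by rewrite -[3%:P]/(3%:R%:P) polyC_natr; ring.
Qed.

Hypothesis L0 : [pchar L] =i pred0.

Lemma line_in_surface_cub l : line_in_surface F l <->
  forall z, z \in val l -> cub c z = 0.
Proof.
split=> [lS z zl|lS u w ul wl].
  have := lS z z zl zl; rewrite alongE => /(congr1 (fun p : {poly L} => p`_0)).
  by rewrite coef_Poly coef0.
have inl s t : cub c (s *: u + t *: w) = 0 by apply: lS; rewrite memvD ?memvZ.
apply: contrapT => /eqP/(poly_nonroot L0)[t]; rewrite alongE horner_Poly /=.
have := inl 1 t; rewrite cub_pencil // => E /eqP[]; rewrite -[RHS]E; ring.
Qed.

(** In the coordinates s and t on the span of u and w, the restricted cubic form is
    k times the product of the linear forms [p.1 * t - p.2 * s],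
    [q.1 * t - q.2 * s] and [r.1 * t - r.2 * s], whose zeros are the points with
    coordinates p, q and r. The identity is expressed on coefficients, so that it
    is preserved by base change; [k = 0] is the case of a line in the surface. *)
Definition splits u w k (p q r : L * L) :=
  [/\ cub c u = - (k * p.2 * q.2 * r.2),
      3 * T u u w = k * (p.1 * q.2 * r.2 + p.2 * q.1 * r.2 + p.2 * q.2 * r.1),
      3 * T u w w = - (k * (p.1 * q.1 * r.2 + p.1 * q.2 * r.1 + p.2 * q.1 * r.1))
    & cub c w = k * p.1 * q.1 * r.1].

Lemma splits_cub u w k p q r s t : splits u w k p q r ->
  cub c (s *: u + t *: w) = k * (p.1 * t - p.2 * s) * (q.1 * t - q.2 * s) *
    (r.1 * t - r.2 * s).
Proof.
case=> E0 E1 E2 E3; rewrite cub_pencil //.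
transitivity (s ^+ 3 * cub c u + s ^+ 2 * t * (3 * T u u w) +
  s * t ^+ 2 * (3 * T u w w) + t ^+ 3 * cub c w); first by ring.
by rewrite E0 E1 E2 E3; ring.
Qed.

Definition split_triple P Q R := exists u w k p q r,
  [/\ indep u w, splits u w k p q r, rep P (p.1 *: u + p.2 *: w),
      rep Q (q.1 *: u + q.2 *: w) & rep R (r.1 *: u + r.2 *: w)].

Lemma split_triple_swap12 P Q R : split_triple P Q R -> split_triple Q P R.
Proof.
case=> u [w [k [p [q [r [i [E0 E1 E2 E3] hP hQ hR]]]]]].
exists u, w, k, q, p, r; split=> //; split.
- by rewrite E0; ring.
- by rewrite E1; ring.
- by rewrite E2; ring.
- by rewrite E3; ring.
Qed.

Lemma split_triple_swap23 P Q R : split_triple P Q R -> split_triple P R Q.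
Proof.
case=> u [w [k [p [q [r [i [E0 E1 E2 E3] hP hQ hR]]]]]].
exists u, w, k, p, r, q; split=> //; split.
- by rewrite E0; ring.
- by rewrite E1; ring.
- by rewrite E2; ring.
- by rewrite E3; ring.
Qed.

Lemma mup0_coef n (p : {poly L}) i : (i < n)%N -> (n <= mup 0 p)%N -> p`_i = 0.
Proof.
move=> i_n; have [->|p0] := eqVneq p 0; first by rewrite coef0.
rewrite mup_geq // subr0 => /dvdpP[q ->].
by rewrite coefMXn i_n.
Qed.

Lemma line_mult_tangent l P x y : (point_space P <= val l)%VS ->
  (1 < line_mult F l (val P))%N -> rep P x -> y \in val l -> T x x y = 0.
Proof.
move=> Pl m2 Px yl; have [x'l y'l i] := line_complement Pl.
have [k k0 ->] := rep_scale (rep_vpick P) Px.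
have [s [t ->]] := line_basis i x'l y'l yl.
set u := vpick _ in i *; set w := vpick _ in i *.
have /(mulfI (natf_neq0_char0 L0 2)) Euuw : 3 * T u u w = 3 * 0.
  have := mup0_coef (isT : (1 < 2)%N) m2; rewrite alongE coef_Poly mulr0; exact.
have u0 : T u u u = 0 := rep_cub (rep_vpick P).
by rewrite triZ1 // triZ2 // triD3 // !triZ3 // u0 Euuw; ring.
Qed.

Lemma line_cycle_swap12 l P Q R : line_cycle l P Q R -> line_cycle l Q P R.
Proof.
case=> hP hQ hR m; split; [exact: hQ|exact: hP|exact: hR|].
move=> X Xl; rewrite (m X Xl).
by case: (X == val P); case: (X == val Q); case: (X == val R).
Qed.

Lemma line_cycle_swap23 l P Q R : line_cycle l P Q R -> line_cycle l P R Q.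
Proof.
case=> hP hQ hR m; split; [exact: hP|exact: hR|exact: hQ|].
move=> X Xl; rewrite (m X Xl).
by case: (X == val P); case: (X == val Q); case: (X == val R).
Qed.

(** Distinct points of the cycle serve as coordinate points u and w. The
    coefficients of the restricted form that vanish are given by the
    multiplicities when points coincide, and otherwise the third point determines
    the ratio of the two remaining ones. *)
Lemma line_cycle_split l P Q R : line_cycle l P Q R -> split_triple P Q R.
Proof.
have three0 := natf_neq0_char0 L0 2.
have double l' P' R' : P' != R' -> line_cycle l' P' P' R' -> split_triple P' P' R'.
  move=> PR [Pl _ Rl /(_ _ Pl)]; rewrite eqxx => m.
  have [Pu Rw] := (rep_vpick P', rep_vpick R').
  have i := rep_indep Pu Rw PR; set u := vpick _ in Pu i; set w := vpick _ in Rw i.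
  have uuw : T u u w = 0.
    by apply: (line_mult_tangent Pl) => //; [rewrite m|rewrite (subvP Rl) ?memv_pick].
  exists u, w, (- (3 * T u w w)), (1, 0), (1, 0), (0, 1).
  rewrite /= !(scale1r, scale0r, add0r, addr0); split=> //; split=> /=.
  - by rewrite (rep_cub Pu); ring.
  - by rewrite uuw; ring.
  - by ring.
  - by rewrite (rep_cub Rw); ring.
have [->|PQ] := eqVneq P Q.
  have [-> [Rl _ _ /(_ _ Rl)]|QR] := eqVneq Q R; last exact: (double l _ _ QR).
  rewrite eqxx => m; have [ul wl i] := line_complement Rl; have Ru := rep_vpick R.
  set u := vpick (val (val R)) in ul i; set w := vpick _ in wl i.
  have uuw : T u u w = 0 by apply: (line_mult_tangent Rl _ Ru wl); rewrite m.
  have /(mulfI three0) uww : 3 * T u w w = 3 * 0.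
    have m3 : (3 <= line_mult F l (val R))%N by rewrite m.
    have := mup0_coef (isT : (2 < 3)%N) m3; rewrite alongE coef_Poly mulr0; exact.
  exists u, w, (cub c w), (1, 0), (1, 0), (1, 0).
  rewrite /= !(scale1r, scale0r, addr0); split=> //; split=> /=.
  - by rewrite (rep_cub Ru); ring.
  - by rewrite uuw; ring.
  - by rewrite uww; ring.
  - by ring.
have [E|QR] := eqVneq Q R.
  rewrite -E => /line_cycle_swap12/line_cycle_swap23 H.
  apply: split_triple_swap12; apply: split_triple_swap23.
  by apply: (double l _ _ _ H); rewrite eq_sym; exact: PQ.
have [->|PR] := eqVneq P R.
  move=> /line_cycle_swap23 H; apply/split_triple_swap23.
  by apply: (double l _ _ _ H); rewrite eq_sym; exact: QR.
move=> [Pl Ql Rl _]; have [Pu Qw Rz] := And3 (rep_vpick P) (rep_vpick Q) (rep_vpick R).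
have [iuw iuz iwz] := And3 (rep_indep Pu Qw PQ) (rep_indep Pu Rz PR) (rep_indep Qw Rz QR).
set u := vpick _ in Pu iuw iuz; set w := vpick _ in Qw iuw iwz.
set z := vpick _ in Rz iuz iwz.
have [s [t zE]] : exists s t, z = s *: u + t *: w.
  apply: (line_basis (l := l)) => //; [exact: (subvP Pl) (memv_pick _)|
    exact: (subvP Ql) (memv_pick _)|exact: (subvP Rl) (memv_pick _)].
have s0 : s != 0.
  apply/eqP => s0; have := iwz t (-1).
  rewrite zE s0 scale0r add0r scaleN1r subrr => /(_ erefl)[_ /eqP].
  by rewrite oppr_eq0 oner_eq0.
have t0 : t != 0.
  apply/eqP => t0; have := iuz s (-1).
  rewrite zE t0 scale0r addr0 scaleN1r subrr => /(_ erefl)[_ /eqP].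
  by rewrite oppr_eq0 oner_eq0.
have uww : 3 * T u w w = - (s * (3 * T u u w / t)).
  have := rep_cub Rz; rewrite zE cub_pencil // (rep_cub Pu) (rep_cub Qw) => E.
  apply: (mulfI (mulf_neq0 s0 (mulf_neq0 t0 t0))).
  transitivity (- (s * s * t * (3 * T u u w))); last by field.
  by apply/eqP; rewrite -subr_eq0 -[X in _ == X]E; apply/eqP; ring.
exists u, w, (3 * T u u w / t), (1, 0), (0, 1), (s, t).
rewrite /= !(scale1r, scale0r, add0r, addr0) -zE; split=> //; split=> /=.
- by rewrite (rep_cub Pu); ring.
- by field.
- by rewrite uww; ring.
- by rewrite (rep_cub Qw); ring.
Qed.

Lemma collinear_split P Q R : collinear_triple P Q R -> split_triple P Q R.
Proof.
case=> l [[_]|[/line_in_surface_cub lS Pl Ql Rl]]; first exact: line_cycle_split.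
have [ul wl i] := line_complement Pl; set u := vpick _ in ul i; set w := vpick _ in wl i.
have coord (S : surface_point F) :
    (point_space S <= val l)%VS -> exists p : L * L, rep S (p.1 *: u + p.2 *: w).
  move=> Sl; have zl : vpick (point_space S) \in val l by exact: (subvP Sl) (memv_pick _).
  have [s [t E]] := line_basis i ul wl zl.
  by exists (s, t); rewrite /= -E; exact: rep_vpick.
have [[p Pp] [q Qq] [r Rr]] := And3 (coord _ Pl) (coord _ Ql) (coord _ Rl).
have cuw s t : cub c (s *: u + t *: w) = 0 by apply: lS; rewrite memvD ?memvZ.
have [u0 w0] : cub c u = 0 /\ cub c w = 0 by rewrite !lS.
have D s t : s * t * (s * (3 * T u u w) + t * (3 * T u w w)) = 0.
  by rewrite -[RHS](cuw s t) cub_pencil // u0 w0; ring.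
set A := 3 * T u u w in D *; set B := 3 * T u w w in D *.
have D1 : A + B = 0 by have := D 1 1; rewrite !mul1r.
have D2 : A - B = 0.
  by apply/eqP; rewrite -oppr_eq0 -[X in _ == X](D 1 (-1)); apply/eqP; ring.
have A0 : A = 0.
  apply: (mulfI (natf_neq0_char0 L0 1)); transitivity (A + B + (A - B)); first by ring.
  by rewrite D1 D2; ring.
have B0 : B = 0 by rewrite -D1 A0 add0r.
exists u, w, 0, p, q, r; split=> //; split; rewrite !mul0r ?oppr0 //.
Qed.

(** The multiplicity at X of a product of linear forms is the number of factors
    that vanish at X. *)
Lemma split_collinear P Q R : split_triple P Q R -> collinear_triple P Q R.
Proof.
case=> u [w [k [p [q [r [i sp Pp Qq Rr]]]]]].
have [l [ul wl]] := line_through i; exists l.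
have inl (S : surface_point F) (m : L * L) :
    rep S (m.1 *: u + m.2 *: w) -> (point_space S <= val l)%VS.
  by move=> /rep_span ->; rewrite -memvE memvD ?memvZ.
have [Pl Ql Rl] := And3 (inl _ _ Pp) (inl _ _ Qq) (inl _ _ Rr).
have [k0|k0] := eqVneq k 0; [right; split=> //|left].
  apply/line_in_surface_cub => z /(line_basis i ul wl)[s [t ->]].
  by rewrite (splits_cub _ _ sp) k0 !mul0r.
have nz (m : L * L) : m.1 *: u + m.2 *: w != 0 -> (m.1 != 0) || (m.2 != 0).
  by apply: contraNT; rewrite negb_or !negbK => /andP[/eqP-> /eqP->]; rewrite !scale0r addr0.
split.
  move/line_in_surface_cub => lS.
  pose f (m : L * L) : {poly L} := m.1 *: 'X - m.2%:P.
  have f0 (m : L * L) : (m.1 != 0) || (m.2 != 0) -> f m != 0.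
    move=> m0; apply/eqP => /polyP E; have := E 1; have := E 0.
    rewrite !coefB !coefZ !coefX !coefC /= !(mulr0, mulr1, sub0r, subr0).
    by move=> /eqP + /eqP; rewrite oppr_eq0 => m2 m1; rewrite m1 m2 in m0.
  have [t] := poly_nonroot L0 (mulf_neq0 (mulf_neq0 (f0 _ (nz _ Pp.1)) (f0 _ (nz _ Qq.1)))
    (f0 _ (nz _ Rr.1))).
  apply/negP/negPn/eqP; apply: (mulfI k0).
  have := lS (1 *: u + t *: w); rewrite (splits_cub _ _ sp) memvD ?memvZ // => /(_ isT) E.
  by rewrite mulr0 -[RHS]E /f !(hornerM, hornerD, hornerN, hornerZ, hornerX, hornerC); ring.
split=> // X Xl; have [xl yl ixy] := line_complement Xl.
rewrite /line_mult; set x := vpick (val X) in xl ixy *; set y := vpick _ in yl ixy *.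
have [al [be xE]] := line_basis i ul wl xl; have [ga [de yE]] := line_basis i ul wl yl.
pose f (m : L * L) : {poly L} := (m.1 * be - m.2 * al)%:P + (m.1 * de - m.2 * ga)%:P * 'X.
have alongf : along F x y = k%:P * f p * f q * f r.
  apply/eqP; rewrite -subr_eq0; apply: contraT => /(poly_nonroot L0)[t].
  have := splits_cub (1 * al + t * ga) (1 * be + t * de) sp.
  have -> : (1 * al + t * ga) *: u + (1 * be + t * de) *: w = 1 *: x + t *: y.
    by rewrite xE yE !scalerDr !scalerDl !scalerA addrACA.
  rewrite cub_pencil // hornerD hornerN alongE horner_Poly /= => E /eqP[].
  rewrite /f !(hornerM, hornerD, hornerX, hornerC); apply/eqP; rewrite subr_eq0; apply/eqP.
  transitivity (1 ^+ 3 * cub c x + 3 * (1 ^+ 2 * t) * T x x y +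
    3 * (1 * t ^+ 2) * T x y y + t ^+ 3 * cub c y); first by ring.
  by rewrite E; ring.
have detN0 : al * de - be * ga != 0.
  apply/eqP => det0; have := ixy de (- be).
  have -> : de *: x + - be *: y = (al * de - be * ga) *: u.
    by rewrite xE yE; apply/rowP => j; rewrite !mxE; ring.
  rewrite det0 scale0r => /(_ erefl)[de0 /eqP]; rewrite oppr_eq0 => /eqP be0.
  have := ixy ga (- al).
  have -> : ga *: x + - al *: y = (be * ga - al * de) *: w.
    by rewrite xE yE; apply/rowP => j; rewrite !mxE; ring.
  rewrite de0 be0 mul0r mulr0 subr0 scale0r => /(_ erefl)[_ /eqP].
  rewrite oppr_eq0 => /eqP al0.
  by have := indep_neq0l ixy; rewrite xE al0 be0 !scale0r addr0 eqxx.
have fN0 (m : L * L) : m.1 *: u + m.2 *: w != 0 -> f m != 0.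
  move=> /nz m0; apply/eqP => /polyP E; have := E 1; have := E 0.
  rewrite !coefD !coefC !coefCM !coefX /= !(mulr0, mulr1, add0r, addr0) => E0 E1.
  have m1 : m.1 = 0.
    apply: (mulIf detN0); rewrite mul0r.
    transitivity (al * (m.1 * de - m.2 * ga) - ga * (m.1 * be - m.2 * al)); first by ring.
    by rewrite E0 E1 !mulr0 subr0.
  have m2 : m.2 = 0.
    apply: (mulIf detN0); rewrite mul0r.
    transitivity (be * (m.1 * de - m.2 * ga) - de * (m.1 * be - m.2 * al)); first by ring.
    by rewrite E0 E1 !mulr0 subr0.
  by rewrite m1 m2 eqxx in m0.
have mupf (S : surface_point F) (m : L * L) :
    rep S (m.1 *: u + m.2 *: w) -> mup 0 (f m) = (X == val S) :> nat.
  move=> Sm; have fm0 := fN0 m Sm.1; set C := m.1 * be - m.2 * al.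
  have x0 : x != 0 := vpick_proj_point X; have xX : x \in val X := memv_pick _.
  have [C0|C0] := eqVneq C 0.
    have -> : X = val S.
      apply/val_inj; rewrite (proj_point_span x0 xX); apply/esym/(proj_point_span x0).
      rewrite -/(point_space S) (rep_span Sm).
      have {C0} C0 : m.1 * be = m.2 * al by apply/eqP; rewrite -subr_eq0 -/C C0.
      have [m1|m1] := eqVneq m.1 0; last first.
        apply/vlineP; exists (al / m.1); apply: (scalerI m1).
        rewrite xE; apply/rowP => j; rewrite !mxE.
        transitivity (m.1 * al * u 0 j + m.1 * be * w 0 j); first by ring.
        by rewrite C0; field.
      have m2 : m.2 != 0 by have := nz _ Sm.1; rewrite m1 eqxx.
      apply/vlineP; exists (be / m.2); apply: (scalerI m2).
      rewrite xE; apply/rowP => j; rewrite !mxE m1.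
      transitivity (m.2 * al * u 0 j + m.2 * be * w 0 j); first by ring.
      by rewrite -C0 m1; field.
    rewrite eqxx; have fE : f m = (m.1 * de - m.2 * ga)%:P * 'X.
      by rewrite /f -/C C0 add0r.
    rewrite fE mupMr; last first.
      by rewrite rootC; apply: contraNneq fm0 => D0; rewrite fE D0 mul0r.
    by have := mup_XsubCX 1 (0 : L) 0; rewrite subr0 expr1 eqxx.
  rewrite mupNroot; last by rewrite /root !hornerE.
  case: eqP => // XS; move/negP: C0 => []; move: xX; rewrite XS.
  rewrite -/(point_space S) (rep_span Sm) => /vlineP[h xh].
  have [|al1 be1] := i (al - h * m.1) (be - h * m.2).
    have /eqP := xh; rewrite -subr_eq0 xE => /eqP <-.
    by apply/rowP => j; rewrite !mxE; ring.
  have alE : al = h * m.1 by apply/eqP; rewrite -subr_eq0 al1.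
  have beE : be = h * m.2 by apply/eqP; rewrite -subr_eq0 be1.
  by rewrite /C alE beE; apply/eqP; ring.
rewrite alongf !mupM ?mulf_neq0 ?fN0 ?polyC_eq0 //; try by case: Pp Qq Rr => ? ? [? ?] [].
rewrite (mupf _ _ Pp) (mupf _ _ Qq) (mupf _ _ Rr) mupNroot ?add0n //.
by rewrite rootC.
Qed.

End Points.

(** * The class of a point is locally constant *)

Section LinearEquivalence.
Context (L : fieldType) (F : cubic_form L).
Implicit Types P Q R : surface_point F.
Local Notation pt P := (Freeg [:: (1, P)] : G_S F).

Definition lin_equiv P Q : Prop := pt P - pt Q \in @G''_S L F.

Lemma lin_equiv_refl P : lin_equiv P P.
Proof. by rewrite /lin_equiv subrr rpred0. Qed.

Lemma lin_equiv_sym P Q : lin_equiv P Q -> lin_equiv Q P.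
Proof. by rewrite /lin_equiv -[pt P - _]opprB rpredN. Qed.

Lemma lin_equiv_trans P Q R : lin_equiv P Q -> lin_equiv Q R -> lin_equiv P R.
Proof. by move=> PQ QR; have := rpredD PQ QR; rewrite addrA subrK. Qed.

Lemma G'_S_sub (D E : G_S F) : G'_S D -> G'_S E -> G'_S (D - E).
Proof.
move=> GD GE B [[B0 BB] sB]; apply/asboolP/BB; rewrite unfold_in; apply/asboolP.
  exact: (GD _ (conj (conj B0 BB) sB)).
exact: (GE _ (conj (conj B0 BB) sB)).
Qed.

Lemma collinear_G'_S P Q R : collinear_triple P Q R -> G'_S (pt P + pt Q + pt R).
Proof. by move=> col B [_]; apply; exists P, Q, R. Qed.

(** The basic move: two collinear triples have the same class. *)
Lemma lin_equiv_third P Q R P' Q' R' :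
  collinear_triple P Q R -> collinear_triple P' Q' R' ->
  lin_equiv P P' -> lin_equiv Q Q' -> lin_equiv R R'.
Proof.
move=> col col' PP QQ; rewrite /lin_equiv.
have -> : pt R - pt R' = (pt P + pt Q + pt R - (pt P' + pt Q' + pt R')) -
    (pt P - pt P') - (pt Q - pt Q').
  rewrite [- (_ + _ + _)]opprD [- (pt P' + _)]opprD addrACA.
  rewrite [pt P + pt Q + _]addrACA -[RHS]addrA -opprD.
  by rewrite [RHS]addrAC subrr add0r.
apply: rpredB => //; apply: rpredB => //.
rewrite unfold_in; apply/andP; split.
  by apply/asboolP; apply: G'_S_sub; exact: collinear_G'_S.
by rewrite degB !degD !degU subrr.
Qed.

Context (c : tensor L).
Hypotheses (sc : symmetric3 c) (Fc : (F : {mpoly L[4]}) = tensor_form c).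
Hypothesis L0 : [pchar L] =i pred0.
Local Notation T := (tri c).

Lemma collinear_rot P Q R : collinear_triple P Q R -> collinear_triple Q R P.
Proof.
move/(collinear_split sc Fc L0)/split_triple_swap12/split_triple_swap23.
exact: (split_collinear sc Fc L0).
Qed.

Lemma collinear_secant x y P Q R : indep x y -> rep P x -> rep Q y ->
  rep R (T x y y *: x - T x x y *: y) -> collinear_triple P Q R.
Proof.
move=> i Px Qy Rz; apply: (split_collinear sc Fc L0).
exists x, y, (-3), (1, 0), (0, 1), (T x y y, - T x x y).
rewrite /= !(scale1r, scale0r, add0r, addr0) scaleNr; split=> //; split=> /=.
- by rewrite (rep_cub sc Fc Px); ring.
- by ring.
- by ring.
- by rewrite (rep_cub sc Fc Qy); ring.
Qed.

Lemma collinear_tangent_residual x e P R : indep x e -> T x x e = 0 -> rep P x ->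
  rep R (cub c e *: x - (3 * T x e e) *: e) -> collinear_triple P P R.
Proof.
move=> i xe Px Rz; apply: (split_collinear sc Fc L0).
exists x, e, 1, (1, 0), (1, 0), (cub c e, - (3 * T x e e)).
rewrite /= !(scale1r, scale0r, add0r, addr0) scaleNr; split=> //; split=> /=.
- by rewrite (rep_cub sc Fc Px); ring.
- by rewrite xe; ring.
- by ring.
- by ring.
Qed.

Lemma collinear_tangent x y P Q : indep x y -> T x x y = 0 -> rep P x ->
  rep Q y -> collinear_triple P P Q.
Proof.
move=> i xy Px Qy; apply: (split_collinear sc Fc L0).
exists x, y, (- (3 * T x y y)), (1, 0), (1, 0), (0, 1).
rewrite /= !(scale1r, scale0r, add0r, addr0); split=> //; split=> /=.
- by rewrite (rep_cub sc Fc Px); ring.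
- by rewrite xy; ring.
- by ring.
- by rewrite (rep_cub sc Fc Qy); ring.
Qed.

End LinearEquivalence.

Section LocalConstancy.
Context (R : realType) (L : fieldType) (a : L -> R).
Hypothesis aP : absolute_value a.
Hypothesis a_complete : complete_for a.
Hypothesis a_nontrivial : exists2 t, t != 0 & a t < 1.
Context (F : cubic_form L) (c : tensor L).
Hypotheses (sc : symmetric3 c) (Fc : (F : {mpoly L[4]}) = tensor_form c).
Hypotheses (nc : nonsingular c) (L0 : [pchar L] =i pred0).
Local Notation T := (tri c).

(** Local constancy of the class, stated for coordinate vectors instead of points
    so that the topology is that of a vector space. *)
Definition good (x : 'rV[L]_4) := near_vector a x
  [set y | forall P Q : surface_point F, rep P x -> rep Q y -> lin_equiv P Q].

Lemma near_tendsv (I : Type) (B : set_system I) {FB : Filter B} f l S :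
  tendsv a B f l -> near_vector a l S -> B [set i | S (f i)].
Proof.
move=> fl [e e0 He]; have near_l : B [set i | forall j, a (f i 0 j - l 0 j) < e].
  exact: filter_forall _ (fun j => fl j e e0).
by apply: filterS near_l => i; exact: He.
Qed.

Lemma tendsv_near_id (x : 'rV[L]_4) : tendsv a (near_vector a x) id x.
Proof. by move=> j; exact: tends_coord. Qed.

Lemma goodZ x k : k != 0 -> good x -> good (k *: x).
Proof.
move=> k0 gx; have kx : k^-1 *: (k *: x) = x by rewrite scalerA mulVf // scale1r.
have to_x : tendsv a (near_vector a (k *: x)) (fun y => k^-1 *: y) x.
  rewrite -{2}kx; apply: (tendsvZ aP); first exact: (tends_cst aP).
  exact: tendsv_near_id.
apply: filterS (near_tendsv to_x gx) => y /= eqv P Q Px Qy; apply: eqv.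
  by rewrite -kx; apply: repZ => //; rewrite invr_eq0.
by apply: repZ => //; rewrite invr_eq0.
Qed.

Lemma good_near x : x != 0 -> cub c x = 0 -> good x ->
  near_vector a x [set y | good y].
Proof.
move=> x0 Fx [e e0 He]; have [P Px] := point_of_rep sc Fc x0 Fx.
exists (e / 2); first by rewrite divr_gt0.
move=> y yx; exists (e / 2); first by rewrite divr_gt0.
move=> z zy Q Q' Qy Qz; apply: (lin_equiv_trans (Q := P)).
  apply/lin_equiv_sym/(He y) => // i; apply: lt_trans (yx i) _.
  by rewrite gtr_pMr // invf_lt1 // ltr1n.
apply: (He z) => // i; apply: le_lt_trans (absB_le aP _ (y 0 i) _) _.
by rewrite [e]splitr ltrD.
Qed.

(** Starting from O, the points R of its residual curve are all equivalent, by the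
    collinear triples (O, O, R); hence so are the points y of the tangent sections
    at these R, by the triples (R, R, y). The point p is chosen by
    [residual_gauss_moves] and [tangent_section_point] so that every point y of the
    surface near p is on such a section, by [polar_root_near]. *)
Lemma exists_good O : O != 0 -> cub c O = 0 ->
  exists p, [/\ p != 0, cub c p = 0 & good p].
Proof.
move=> ON0 O0.
have [O' [b [FO' Ob Obb]]] := exists_nonconical_section aP a_complete a_nontrivial sc nc L0 ON0 O0.
move: ON0 O0 => _ _; move: O' FO' Ob Obb => {}O O0 Ob Obb.
have ON0 : O != 0.
  by apply: contraNneq Obb => ->; rewrite triC13 // tri03.
have [u [Ou uOb]] := tangent_plane_third sc O b.
set RP := residual c O u b; set d := line_param u b.
set q := tri (tmap polyC c) (map_mx polyC O) d d.
pose Rv t := map_mx (horner_eval t) RP.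
pose Rv' t := map_mx (horner_eval t) (map_mx deriv RP).
have scP : symmetric3 (tmap polyC c) by exact: symmetric3_map.
have RvE t : Rv t = cub c (u + t *: b) *: O - (3 * T O (u + t *: b) (u + t *: b)) *: (u + t *: b).
  rewrite /Rv /RP /residual -[3 in LHS]polyC_natr; apply/rowP => j.
  rewrite !mxE /horner_eval.
  rewrite !(hornerM, hornerD, hornerN, hornerX, hornerC) /cub !horner_tri //.
  rewrite !ev_polyC !ev_line_param; ring.
have qE t : q.[t] = T O (u + t *: b) (u + t *: b).
  by rewrite /q horner_tri // ev_polyC ev_line_param.
have cubR t : cub c (Rv t) = 0.
  by rewrite /cub -horner_tri // -[tri _ _ _ _]/(cub _ _) cub_residual // horner0.
have triRR' t : T (Rv t) (Rv t) (Rv' t) = 0.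
  apply: (mulfI (natf_neq0_char0 L0 2)); rewrite mulr0.
  have /(congr1 (fun p : {poly L} => p^`().[t])) := cub_residual sc O0 Ou Ob.
  rewrite deriv0 horner0 /cub deriv_tri !hornerD !horner_tri // => E.
  rewrite -[RHS]E (triC13 sc (Rv' t)) (triC23 sc (Rv t) (Rv' t)); ring.
have RN0 t : q.[t] != 0 -> Rv t != 0.
  apply: contraNneq => R0; have := congr1 (horner_eval t) (tri_residual sc O0 Ou Ob).
  rewrite /horner_eval horner_tri // ev_polyC -/RP -/(Rv t) R0 triC13 // tri03 // => /esym/eqP.
  rewrite -polyC_natr hornerM hornerC horner_exp mulf_eq0 (negPf (natf_neq0_char0 L0 8)).
  by rewrite expf_eq0.
have dN v t : (tri (tmap polyC c) RP RP (map_mx polyC v))^`().[t] = 2 * T (Rv t) (Rv' t) v.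
  rewrite deriv_tri !hornerD !horner_tri // deriv_polyC ev_polyC map_mx0 tri03 //.
  by rewrite (triC12 sc (Rv' t)); ring.
have [t0 [v [q0 W0]]] := residual_gauss_moves sc O0 Ou Ob nc L0 Obb uOb.
have m0 : T (Rv t0) (Rv' t0) (T (Rv t0) (Rv t0) O *: v - T (Rv t0) (Rv t0) v *: O) != 0.
  apply: contraNneq W0; rewrite triD3 // triN3 // !triZ3 // => W.
  rewrite hornerD hornerN !hornerM !dN !horner_tri // !ev_polyC -/(Rv t0).
  apply/eqP; transitivity (2 * (T (Rv t0) (Rv t0) O * T (Rv t0) (Rv' t0) v -
    T (Rv t0) (Rv t0) v * T (Rv t0) (Rv' t0) O)); first by ring.
  by rewrite W mulr0.
have e0 : T (Rv t0) (Rv t0)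
    (T (Rv t0) (Rv t0) O *: v - T (Rv t0) (Rv t0) v *: O) = 0.
  by rewrite triD3 // triN3 // !triZ3 // mulrC subrr.
have [p [p0 Rp R'p]] := tangent_section_point sc (natf_neq0_char0 L0 1)
  (natf_neq0_char0 L0 2) (cubR t0) (triRR' t0) e0 m0.
have pN0 : p != 0 by apply: contraNneq R'p => ->; rewrite tri03.
exists p; split=> //.
apply: filterS (polar_root_near aP a_complete sc L0 q0 Rp R'p).
move=> y /= [t [qt Ry R'y]] P Q Pp Qy.
have [PO rO] := point_of_rep sc Fc ON0 O0.
have [Z rZ] := point_of_rep sc Fc (RN0 _ q0) (cubR t0).
have [Z' rZ'] := point_of_rep sc Fc (RN0 _ qt) (cubR t).
have colO s (X : surface_point F) : q.[s] != 0 -> rep X (Rv s) -> collinear_triple PO PO X.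
  move=> qs; rewrite RvE => rX; apply: (collinear_tangent_residual sc Fc L0 _ _ rO rX).
    apply: (indepPn ON0) => k; apply: contraNneq qs => dE.
    by rewrite qE dE triZ2 // triZ3 // [T O O O]O0 !mulr0.
  by rewrite triD3 // triZ3 // Ou Ob mulr0 addr0.
have colR s (X S : surface_point F) y' : q.[s] != 0 -> rep X (Rv s) -> rep S y' ->
    T (Rv s) (Rv s) y' = 0 -> T (Rv s) (Rv' s) y' != 0 -> collinear_triple X X S.
  move=> qs rX rS Ry' R'y'; apply: (collinear_tangent sc Fc L0 _ Ry' rX rS).
  apply: (indepPn rX.1) => k; apply: contraNneq R'y' => ->.
  by rewrite triZ3 // triC23 // triRR' mulr0.
have ZZ' : lin_equiv Z Z'.
  exact: (lin_equiv_third (colO _ _ q0 rZ) (colO _ _ qt rZ') (lin_equiv_refl _) (lin_equiv_refl _)).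
exact: (lin_equiv_third (colR _ _ _ _ q0 rZ Pp Rp R'p) (colR _ _ _ _ qt rZ' Qy Ry R'y) ZZ' ZZ').
Qed.

(** If p is on the tangent plane at x, one moves from p along the graph given by
    [surface_graph]. When some n is in the tangent plane at x but not in that at p,
    the graph in the direction n over a line that leaves the plane works. Otherwise
    both planes coincide, and one takes the graph over a line in this plane that is
    not on the surface. *)
Lemma leave_tangent_plane x p (S : set 'rV[L]_4) : x != 0 -> p != 0 ->
  cub c p = 0 -> near_vector a p S ->
  exists q, [/\ S q, cub c q = 0 & T x x q != 0].
Proof.
move=> x0 pN0 p0 nS; have [xp|xp] := eqVneq (T x x p) 0; last first.
  by exists p; split=> //; case: nS => e e0; apply=> i; rewrite subrr abs0.
have leave v n : T p p n != 0 -> exists2 e, 0 < e &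
    forall h, a h < e -> exists y, S (p + h *: v + y *: n) /\
      cub c (p + h *: v + y *: n) = 0.
  move=> pn; pose B := filter_prod (near_scalar a 0) (near_scalar a 0).
  have to_p : tendsv a B (fun s => p + s.1 *: v + s.2 *: n) p.
    have {2}-> : p = p + 0 *: v + 0 *: n by rewrite !scale0r !addr0.
    apply: (tendsvD aP); first apply: (tendsvD aP); first exact: (tendsv_cst aP).
      apply: (tendsvZ aP); last exact: (tendsv_cst aP).
      exact: (tends_fst (@tends_id _ _ _ 0)).
    apply: (tendsvZ aP); last exact: (tendsv_cst aP).
    exact: (tends_snd (@tends_id _ _ _ 0)).
  have [[N1 N2] /= [[e1 e10 He1] [e2 e20 He2]] sub] := near_tendsv to_p nS.
  have [d d0 Hd] := surface_graph aP a_complete sc L0 v p0 pn e20.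
  exists (Num.min e1 d); first by rewrite lt_min e10.
  move=> h; rewrite lt_min => /andP[he1 hd]; have [y ye py] := Hd h hd.
  exists y; split=> //; apply: (sub (h, y)); split=> /=.
    by apply: He1; rewrite subr0.
  by apply: He2; rewrite subr0.
have [[n [xn pn]]|same] := pselect (exists n, T x x n = 0 /\ T p p n != 0).
  have [v xv] := gauss_neq0 nc x0.
  have [e e0 He] := leave v n pn.
  have X0 : 'X != 0 :> {poly L} by rewrite polyX_eq0.
  have [h he] := small_nonroot aP a_nontrivial X0 e0; rewrite hornerX => h0.
  have [y [Sy Fy]] := He h he; exists (p + h *: v + y *: n); split=> //.
  by rewrite !triD3 // !triZ3 // xp xn mulr0 addr0 add0r mulf_neq0.
have [n pn] := gauss_neq0 nc pN0.
have xn : T x x n != 0.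
  by apply/eqP => xn; apply: same; exists n.
have [w [xw Fw]] := tangent_plane_off sc nc L0 x0.
have [e e0 He] := leave w n pn.
pose f : {poly L} := Poly [:: 0; 3 * T p p w; 3 * T p w w; cub c w].
have f0 : f != 0.
  apply: contraNneq Fw => /(congr1 (fun g : {poly L} => g`_3)).
  by rewrite coef_Poly coef0 /= => ->.
have fE h : f.[h] = cub c (p + h *: w).
  rewrite horner_Poly /= -[p in RHS]scale1r cub_pencil // p0; ring.
have [h he fh] := small_nonroot aP a_nontrivial f0 e0.
have [y [Sy Fy]] := He h he; exists (p + h *: w + y *: n); split=> //.
rewrite !triD3 // !triZ3 // xp xw mulr0 !add0r mulf_neq0 //.
by apply: contraNneq fh => y0; rewrite fE; move: Fy; rewrite y0 scale0r addr0 => ->.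
Qed.

(** Let A be the third point on the line through x and q. The map tau, sending y to
    the third point on the line through y and A, is continuous at x, takes x to q
    and, by [lin_equiv_third], reflects equivalence: local constancy at q pulls
    back to x. *)
Lemma good_secant x q : x != 0 -> cub c x = 0 -> cub c q = 0 ->
  T x x q != 0 -> good q -> good x.
Proof.
move=> x0 Fx Fq xq gq; set al := T x x q in xq; set be := T x q q.
pose A := be *: x - al *: q.
have xA : T x x A = - al ^+ 2.
  by rewrite /A triD3 // triN3 // !triZ3 // [T x x x]Fx -/al; ring.
have FA : cub c A = 0.
  by rewrite /A -scaleNr cub_pencil // Fx Fq -/al -/be; ring.
have xAN0 : T x x A != 0 by rewrite xA oppr_eq0 expf_neq0.
have A0 : A != 0 by apply: contraNneq xAN0 => ->; rewrite tri03.
pose tau y := T y A A *: y - T y y A *: A.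
have tau_x : tau x = (- al ^+ 3) *: q.
  have xAA : T x A A = - (al ^+ 2 * be).
    rewrite {1}/A triD2 // triN2 // !triZ2 // xA.
    by rewrite /A triD3 // triN3 // !triZ3 // (triC23 sc x q x) -/al -/be; ring.
  rewrite /tau xA xAA /A; apply/rowP => j; rewrite !mxE; ring.
have xtau : T x x (tau x) != 0.
  by rewrite tau_x triZ3 // -/al mulf_neq0 // oppr_eq0 expf_neq0.
have gtau : good (tau x).
  by rewrite tau_x; apply: goodZ => //; rewrite oppr_eq0 expf_neq0.
have id_to : tendsv a (near_vector a x) id x := @tendsv_near_id x.
have A_to : tendsv a (near_vector a x) (fun=> A) A by exact: (tendsv_cst aP).
have tau_to : tendsv a (near_vector a x) tau (tau x).
  have -> : tau = fun y => T y A A *: y + (- T y y A) *: A.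
    by apply/funext => y; rewrite scaleNr.
  cbv beta; apply: (tendsvD aP); apply: (tendsvZ aP) => //.
    by apply: (tends_tri aP).
  by apply: (tendsN aP); apply: (tends_tri aP).
have near_A : near_vector a x [set y | T y y A != 0].
  by apply: (tends_neq0 aP) xAN0; apply: (tends_tri aP).
have near_tau : near_vector a x [set y | T x x (tau y) != 0].
  by apply: (tends_neq0 aP) xtau; apply: (tends_tri aP) => //; exact: (tendsv_cst aP).
have [PA rA] := point_of_rep sc Fc A0 FA.
have col y (P : surface_point F) : rep P y -> T y y A != 0 -> tau y != 0 ->
    exists2 C : surface_point F, rep C (tau y) & collinear_triple P PA C.
  move=> Py yA ty0.
  have i : indep y A.
    apply: (indepPn Py.1) => k; apply: contraNneq yA => ->.
    by rewrite triZ3 // [T y y y](rep_cub sc Fc Py) mulr0.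
  have Ft : cub c (tau y) = 0.
    by rewrite /tau -scaleNr cub_pencil // FA (rep_cub sc Fc Py); ring.
  have [C rC] := point_of_rep sc Fc ty0 Ft; exists C => //.
  exact: (collinear_secant sc Fc L0 i Py rA rC).
apply: filterS (filterI (filterI near_A near_tau) (near_tendsv tau_to gtau)).
move=> y /= [[yA ytau] eqv] P Q Px Qy.
have tau_neq0 z : T x x (tau z) != 0 -> tau z != 0.
  by apply: contraNneq => ->; rewrite tri03.
have [C rC colC] := col _ _ Px xAN0 (tau_neq0 _ xtau).
have [C' rC' colC'] := col _ _ Qy yA (tau_neq0 _ ytau).
have rot := collinear_rot sc Fc L0.
exact: (lin_equiv_third (rot _ _ _ colC) (rot _ _ _ colC') (lin_equiv_refl _)
  (eqv _ _ rC rC')).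
Qed.

Lemma good_all x : x != 0 -> cub c x = 0 -> good x.
Proof.
move=> x0 Fx; have [p [p0 Fp gp]] := exists_good x0 Fx.
have [q [gq Fq xq]] := leave_tangent_plane x0 p0 Fp (good_near p0 Fp gp).
exact: (good_secant x0 Fx Fq xq gq).
Qed.

End LocalConstancy.

(** * Base change and completions *)

Section BaseChangeClass.
Context (L M : fieldType) (f : {rmorphism L -> M}) (F : cubic_form L).
Context (c : tensor L).
Hypotheses (sc : symmetric3 c) (Fc : (F : {mpoly L[4]}) = tensor_form c).
Hypothesis L0 : [pchar L] =i pred0.

Lemma map_cubic_tensor :
  (map_cubic f F : {mpoly M[4]}) = tensor_form (tmap f c).
Proof. by rewrite /= Fc map_tensor_form. Qed.

Lemma rep_map (P : surface_point F) x : rep P x -> rep (map_point f P) (map_mx f x).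
Proof.
move=> Px; have [k k0 ->] := rep_scale (rep_vpick P) Px.
rewrite map_mxZ; apply: repZ; first by rewrite fmorph_eq0.
by split; [rewrite map_mx_eq0; exact: (rep_vpick P).1|exact: memv_line].
Qed.

Lemma indep_map (u w : 'rV[L]_4) : indep u w -> indep (map_mx f u) (map_mx f w).
Proof.
move/indep_row_free; rewrite -(row_free_map f) map_col_mx => fr s t E.
have /eqP : row_mx s%:M t%:M *m col_mx (map_mx f u) (map_mx f w) = 0.
  by rewrite mul_row_col !mul_scalar_mx.
rewrite mulmx_free_eq0 // => /eqP E0.
have := congr1 lsubmx E0; have := congr1 rsubmx E0.
rewrite row_mxKl row_mxKr !raddf0 => /matrixP/(_ 0 0) + /matrixP/(_ 0 0).
by rewrite !mxE /= !mulr1n.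
Qed.

Lemma collinear_map P Q R : @collinear_triple L F P Q R ->
  collinear_triple (map_point f P) (map_point f Q) (map_point f R).
Proof.
have M0 : [pchar M] =i pred0 by move=> n; rewrite (fmorph_pchar f).
move/(collinear_split sc Fc L0) => [u [w [k [p [q [r [i [E0 E1 E2 E3] Pp Qq Rr]]]]]]].
apply: (split_collinear (symmetric3_map f sc) map_cubic_tensor M0).
pose fp (m : L * L) := (f m.1, f m.2).
have repE (S : surface_point F) (m : L * L) : rep S (m.1 *: u + m.2 *: w) ->
    rep (map_point f S) ((fp m).1 *: map_mx f u + (fp m).2 *: map_mx f w).
  by move/rep_map; rewrite map_mxD !map_mxZ.
exists (map_mx f u), (map_mx f w), (f k), (fp p), (fp q), (fp r).
split; try exact: repE; first exact: indep_map.
have three : 3 = f 3 by rewrite rmorph_nat.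
by split; rewrite /cub !tri_map ?three /= -!(rmorphM, rmorphD, rmorphN);
  congr (f _).
Qed.

Lemma map_G_pt (P : surface_point F) :
  map_G f (Freeg [:: (1, P)]) = Freeg [:: (1, map_point f P)].
Proof. by rewrite /map_G liftU scale1r. Qed.

Lemma map_G'_S (D : G_S F) : G'_S D -> G'_S (map_G f D).
Proof.
move=> GD; apply: (GD [set D | G'_S (map_G f D)]); split.
  split; first by rewrite unfold_in; apply/asboolP => B [[/asboolP]]; rewrite raddf0.
  move=> x y; rewrite !unfold_in => /asboolP Gx /asboolP Gy; apply/asboolP.
  by rewrite /= raddfB; exact: G'_S_sub.
move=> _ [P [Q [R [col ->]]]] /=; rewrite !raddfD /= !map_G_pt.
exact: collinear_G'_S (collinear_map col).
Qed.

Lemma map_G''_S (D : G_S F) : D \in @G''_S L F -> map_G f D \in @G''_S M (map_cubic f F).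
Proof.
rewrite !unfold_in => /andP[/asboolP GD dD]; rewrite deg_map_G dD andbT.
by apply/asboolP; exact: map_G'_S GD.
Qed.

Lemma pi_H_eq (N : fieldType) (E : cubic_form N) (x y : G_S E) :
  x - y \in @G''_S N E -> \pi_(H_S E) x = \pi_(H_S E) y.
Proof. by rewrite Quotient.idealrBE => /eqP. Qed.

Lemma map_H_pi (D : G_S F) :
  map_H f (\pi_(H_S F) D) = \pi_(H_S (map_cubic f F)) (map_G f D).
Proof.
rewrite /map_H; apply: pi_H_eq; rewrite -raddfB; apply: map_G''_S.
by rewrite Quotient.idealrBE reprK.
Qed.

End BaseChangeClass.

(** The absolute value of K_v is nontrivial because a power of it is so on K;
    if it exceeds 1 at y, it is less than 1 at the inverse of y. *)
Lemma completion_nontrivial (R : realType) (K : fieldType) (v : place R K)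
    (Kv : completion v) :
  exists2 t : Kv, t != 0 & completion_abs t < 1.
Proof.
have aP := completion_absP Kv.
have [b [bP [x x0 bx1] vE]] : exists b : K -> R,
    [/\ absolute_value b, exists2 x, x != 0 & b x != 1
      & place_class v = [set b' | absolute_value b' /\
                         exists2 s, 0 < s & forall x, b' x = b x `^ s]].
  by case: (v).
have := completion_emb_class Kv; rewrite vE => -[_ [s s0 Es]].
set y := completion_emb Kv x; have y0 : y != 0 by rewrite fmorph_eq0.
have ay1 : completion_abs y != 1.
  have -> : completion_abs y = b x `^ s := Es x; rewrite powR_eq1.
  by rewrite !negb_or bx1 -leNgt (abs_ge0 bP) gt_eqF.
have ay0 : 0 < completion_abs y by rewrite (abs_gt0 aP).
have [ylt|ygt|yeq] := ltgtP (completion_abs y) 1; first by exists y.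
  exists y^-1; first by rewrite invr_eq0.
  rewrite -(ltr_pM2l ay0) -(absM aP) mulfV // (abs1 aP) mulr1 //.
by rewrite yeq eqxx in ay1.
Qed.

Lemma pchar_number_field (K : fieldExtType rat) : [pchar K] =i pred0.
Proof. by move=> p; rewrite (fmorph_pchar (in_alg K)) pchar_num. Qed.

Section Local.
Context (R : realType) (K : fieldExtType rat) (v : place R K) (Kv : completion v).
Context (F : cubic_form K).
Hypothesis sF : smooth F.

(** Local constancy of the class, [good_all], in the topology of S(K_v). *)
Lemma open_lin_equiv (P : local_point Kv F) :
  open [set Q : local_point Kv F | lin_equiv Q P].
Proof.
have K0 := pchar_number_field K.
have [c sc Fc] := cubic_tensor F K0.
have L0 : [pchar Kv] =i pred0.
  by move=> p; rewrite (fmorph_pchar (completion_emb Kv)) K0.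
have nc := nonsingular_map (completion_emb Kv) (smooth_nonsingular sc Fc sF).
have scv := symmetric3_map (completion_emb Kv) sc.
have Fcv := map_cubic_tensor (completion_emb Kv) Fc.
suff : local_open [set Q : local_point Kv F | lin_equiv Q P] by [].
move=> Q x QP x0 xQ; have Qx : rep Q x by [].
have [e e0 He] := good_all (completion_absP Kv) (@completion_complete _ _ _ Kv)
  (completion_nontrivial Kv) scv Fcv nc L0 x0 (rep_cub scv Fcv Qx).
exists e => // Q' y y0 yQ' yx; apply: (lin_equiv_trans (Q := Q)) => //.
by apply: lin_equiv_sym; exact: (He y yx).
Qed.

End Local.

(** * Approximation by rational points *)

Section Approximation.
Context (R : realType) (K : fieldExtType rat).
Context (Kv : forall v : place R K, completion v).
Context (F : cubic_form K) (Sigma Delta : set (place R K)).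
Hypothesis sF : smooth F.
Hypothesis dense_diagonal : dense (range (adelic_diagonal Kv Sigma :
  surface_point F -> adelic_point Kv F Sigma)).
Hypothesis finite_Delta : finite_set Delta.
Hypothesis Delta_Sigma : Delta `<=` ~` Sigma.

Local Notation emb v := (completion_emb (Kv v)).
Local Notation pt P := (Freeg [:: (1, P)]).

(** The equivalence classes of the y v, for v in Delta, and all local points at the
    other places form a nonempty open box of adelic points. *)
Lemma approximate_classes (y : forall v, local_point (Kv v) F) :
  exists P : surface_point F,
    forall v, Delta v -> lin_equiv (map_point (emb v) P) (y v).
Proof.
pose U (v : ~` Sigma) : set (local_point (Kv (set_val v)) F) :=
  [set Q | Delta (set_val v) -> lin_equiv Q (y (set_val v))].
have openU v : open (U v).
  have [Dv|nDv] := pselect (Delta (set_val v)); last first.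
    have -> : U v = setT by apply/seteqP; split=> // Q _ /nDv.
    exact: openT.
  have -> : U v = [set Q | lin_equiv Q (y (set_val v))].
    by apply/seteqP; split=> Q; [apply|move=> QP _].
  exact: open_lin_equiv.
have almost_U : almost_all Kv (fun v => U v = @integral_points R K _ (Kv (set_val v)) F).
  apply: (@sub_finite_set _ _ [set v : ~` Sigma | Delta (set_val v)]).
    move=> v [_ UI]; apply: contrapT => nDv; apply: UI.
    apply/seteqP; split=> [Q _|Q _ /nDv //]; exact: local_point_integral.
  apply: (@finite_preimage _ _ Delta set_val) => //.
  by move=> v w _ _; exact: val_inj.
pose B : set (adelic_point Kv F Sigma) := [set P | forall v, U v (P v)].
have oB : open B.
  exists [set B]; last by rewrite bigcup_set1.
  by move=> _ ->; apply: finI_from1; exists U.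
have B0 : B !=set0.
  have ay : almost_all Kv (fun v : ~` Sigma => integral_points (y (set_val v))).
    apply: (@sub_finite_set _ _ set0); last exact: finite_set0.
    by move=> v [_]; apply; exact: local_point_integral.
  by exists (AdelicPoint ay) => v Dv; exact: lin_equiv_refl.
have [Q [BP [P _ PE]]] := dense_diagonal B0 oB.
exists P => v Dv; move: BP; rewrite -PE /B /= => BP.
have Sv : (~` Sigma) v := Delta_Sigma Dv.
exact: (BP (SigSub (mem_set Sv)) Dv).
Qed.

(** As the coefficients of D add up to zero, b may be subtracted from each point. *)
Lemma freeg_deg0 (L : fieldType) (E : cubic_form L) (D : G_S E) (b : surface_point E) :
  deg D = 0 ->
  D = \sum_(P <- dom D) (pt P - pt b : G_S E) *~ coeff P D.
Proof.
move=> dD; have ptE P (k : int) : (pt P : G_S E) *~ k = Freeg [:: (k, P)].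
  by rewrite freegU_mulz intz.
rewrite (eq_bigr (fun P => Freeg [:: (coeff P D, P)] - (pt b : G_S E) *~ coeff P D)); last first.
  by move=> P _; rewrite mulrzBl ptE.
rewrite sumrB freeg_sumE -mulrz_sumr.
have -> : \sum_(P <- dom D) coeff P D = deg D.
  rewrite -[D in RHS]freeg_sumE raddf_sum /=.
  by apply: eq_bigr => P _; rewrite degU.
by rewrite dD mulr0z subr0.
Qed.

(** Each generator [pt P - pt b] of the divisors of degree zero at v is replaced by
    the difference of two rational points. The first is equivalent to P at v and to
    the base point at the other places of Delta, the second to the base point at
    all of them, so that the difference is trivial away from v. *)
Lemma lift_one_place (b : forall v, local_point (Kv v) F) (v : place R K)
    (E : G_S (map_cubic (emb v) F)) : deg E = 0 -> Delta v ->
  exists D : G_S F, [/\ deg D = 0, map_G (emb v) D - E \in @G''_S _ _ &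
    forall w, Delta w -> w <> v -> map_G (emb w) D \in @G''_S _ _].
Proof.
move=> dE Dv; have [q qb] := approximate_classes b.
have near_P (P : local_point (Kv v) F) : exists p : surface_point F,
    lin_equiv (map_point (emb v) p) P /\
    forall w, Delta w -> w <> v -> lin_equiv (map_point (emb w) p) (b w).
  have [y [yv yb]] : exists y : forall w, local_point (Kv w) F,
      y v = P /\ forall w, w <> v -> y w = b w.
    exists (fun w => match pselect (v = w) with
      | left e => eq_rect v (fun w => local_point (Kv w) F) P w e
      | right _ => b w end); split=> [|w wv].
      case: pselect => // e; rewrite (_ : e = erefl) //; exact: Prop_irrelevance.
    by case: pselect => // e; case: wv.
  have [p py] := approximate_classes y; exists p; split; first by rewrite -yv; exact: py.
  by move=> w Dw wv; rewrite -(yb w wv); exact: py.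
have [p pP] := choice near_P.
pose D : G_S F := \sum_(P <- dom E) (pt (p P) - pt q) *~ coeff P E.
have mapD w : map_G (emb w) D = \sum_(P <- dom E)
    (pt (map_point (emb w) (p P)) - pt (map_point (emb w) q)) *~ coeff P E.
  rewrite /D raddf_sum; apply: eq_bigr => P _.
  by rewrite raddfMz raddfB /= !map_G_pt.
exists D; split.
- rewrite /D (raddf_sum (@deg _)) big1 // => P _.
  have degBG (x y : G_S F) : deg (x - y) = deg x - deg y by exact: degB.
  by rewrite (raddfMz (@deg _)) /= degBG !degU subrr mul0rz.
- rewrite mapD {3}(freeg_deg0 (b v) dE) -sumrB; apply: rpred_sum => P _.
  rewrite -mulrzBl; apply: rpredMz.
  have swap (V : zmodType) (x y z t : V) : x - y - (z - t) = x - z - (y - t).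
    by rewrite !opprB addrACA [RHS]addrACA [- y - z]addrC.
  by rewrite swap; apply: rpredB; [exact: (pP P).1|exact: qb].
move=> w Dw wv; rewrite mapD; apply: rpred_sum => P _; apply: rpredMz.
exact: lin_equiv_trans ((pP P).2 w Dw wv) (lin_equiv_sym (qb w Dw)).
Qed.

(** The lifts for the individual places are added up; each one contributes nothing
    at the other places. *)
Lemma lift_all_places (b : forall v, local_point (Kv v) F)
    (E : forall v, G_S (map_cubic (emb v) F)) : (forall v, deg (E v) = 0) ->
  exists D : G_S F, deg D = 0 /\
    forall v, Delta v -> map_G (emb v) D - E v \in @G''_S _ _.
Proof.
move=> dE; have [s sE] : exists s : seq {classic (place R K)}, Delta = [set` s].
  exact/finite_seqP.
suff [D [dD DE]] : exists D : G_S F, deg D = 0 /\ forall w : {classic (place R K)},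
    Delta w -> (w \in undup s -> map_G (emb w) D - E w \in @G''_S _ _) /\
               (w \notin undup s -> map_G (emb w) D \in @G''_S _ _).
  exists D; split=> // v Dv; apply: (DE v Dv).1; rewrite mem_undup.
  by move: Dv; rewrite sE.
have sub_s (v : {classic (place R K)}) : v \in undup s -> Delta v.
  by rewrite mem_undup sE.
have := undup_uniq s; elim: (undup s) sub_s => [|v r IHr] sub_r.
  exists 0; split=> [|w _]; first exact: deg0.
  by split=> // _; rewrite raddf0 rpred0.
move=> /= /andP[vr /IHr[|D [dD DE]]].
  by move=> w wr; apply: sub_r; rewrite inE wr orbT.
have Dv : Delta v by apply: sub_r; rewrite inE eqxx.
have [D' [dD' D'v D'w]] := lift_one_place b (dE v) Dv.
exists (D + D'); split; first by rewrite degD dD dD' addr0.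
move=> w Dw; have [Dr Dnr] := DE w Dw; rewrite raddfD inE.
have [wv|/eqP wv] := eqVneq w v; split=> //= wr.
- subst w; rewrite -addrA; apply: rpredD => //; exact: Dnr.
- by rewrite addrAC; apply: rpredD; [exact: Dr|exact: D'w].
- by apply: rpredD; [exact: Dnr|exact: D'w].
Qed.

End Approximation.

Theorem theorem10 (R : realType) (K : fieldExtType rat)
    (Kv : forall v : place R K, completion v)
    (F : cubic_form K) (Sigma Delta : set (place R K)) :
  smooth F ->
  [set: adelic_point Kv F set0] !=set0 ->
  dense (range (adelic_diagonal Kv Sigma :
                  surface_point F -> adelic_point Kv F Sigma)) ->
  finite_set Delta ->
  Delta `<=` ~` Sigma ->
  forall d : forall v : Delta,
      H0_S (map_cubic (completion_emb (Kv (set_val v))) F),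
  exists D : H0_S F,
    forall v : Delta, map_H0 (completion_emb (Kv (set_val v))) D = d v.
Proof.
move=> sF [b0 _] dense_diagonal finite_Delta Delta_Sigma d.
have notin0 (v : place R K) : (~` set0) v by [].
pose b v : local_point (Kv v) F := b0 (SigSub (mem_set (notin0 v))).
pose E v : G_S (map_cubic (completion_emb (Kv v)) F) :=
  match pselect (Delta v) with
  | left Dv => repr (val (d (SigSub (mem_set Dv))))
  | right _ => 0
  end.
have dE v : deg (E v) = 0.
  rewrite /E; case: pselect => [Dv|_]; last exact: deg0.
  exact/eqP/(valP (d (SigSub (mem_set Dv)))).
have Ed (v : Delta) : E (set_val v) = repr (val (d v)).
  case: v => w wD; rewrite /E /=; case: pselect => [Dv|[]]; last exact: set_mem wD.
  by rewrite (bool_irrelevance (mem_set Dv) wD).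
have [D [dD DE]] := lift_all_places sF dense_diagonal finite_Delta Delta_Sigma b dE.
have dH : degH (\pi_(H_S F) D) == 0 by rewrite degH_pi dD.
exists (exist _ (\pi_(H_S F) D) dH) => v; apply: val_inj => /=.
have [c sc Fc] := cubic_tensor F (pchar_number_field K).
rewrite (map_H_pi _ sc Fc (pchar_number_field K)) -[RHS]reprK -Ed.
by apply: pi_H_eq; apply: DE; exact: set_valP.
Qed.
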